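(* Let $U_{q,\Gamma_\pm}(\mathfrak{b}_\pm)$ be opposite Borel quantum subgroups, where $\Gamma_+,\Gamma_-$ are lattices in $\mathbb{Q}Q$ containing $Q$, and let $\eta:U_{q,\Gamma_+}(\mathfrak{b}_+)\otimes_{\Bbbk_q}U_{q,\Gamma_-}(\mathfrak{b}_-)\to\Bbbk_q$ be the standard skew-Hopf pairing. Given $\Psi\in\mathfrak{so}_n(\mathbb{Q})$, let $$\Gamma'_\pm:=(\mathrm{id}+\psi_+)(\Gamma_\pm)-\psi_-(\Gamma_\mp)+Q_\pm ,$$ where $Q_\pm$ denotes the copy of $Q$ relative to the sign $\pm$. For every $2$-cocycle $\sigma\in\mathcal{Z}^2\big(U_{q,\Gamma'_-}(\mathfrak{b}_-),\Bbbk_q\big)$, consider the corresponding twistings $U^\Psi_{q,\Gamma'_+}(\mathfrak{b}_+)$ and $\big(U_{q,\Gamma'_-}(\mathfrak{b}_-)\big)_\sigma$. Then the extended linear map $$\eta:U^\Psi_{q,\Gamma'_+}(\mathfrak{b}_+)\otimes_{\Bbbk_q}\big(U_{q,\Gamma'_-}(\mathfrak{b}_-)\big)_\sigma\longrightarrow\Bbbk_q ,$$ given by the standard pairing for the lattices $\Gamma'_+$, $\Gamma'_-$, is again a skew-Hopf pairing with respect to the new, deformed Hopf structures if and only if $\Psi\longleftrightarrow\sigma$, that is, if and only if $\sigma$ is the toral $2$-cocycle corresponding to $\Psi$, given by $$\sigma(K_{\alpha_i},K_{\alpha_j})=q^{-(A^T\Psi A)_{ij}}\qquad(i,j\in I).$$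 In other words, the deformed coproduct $\Delta^{(\Psi)}$ on $U_{q,\Gamma'_+}(\mathfrak{b}_+)$ and the deformed product $\cdot_\sigma$ on $U_{q,\Gamma'_-}(\mathfrak{b}_-)$ are dual to each other (via $\eta$) if and only if $\Psi\longleftrightarrow\sigma$. A symmetric, parallel result holds true when switching the roles of $\Psi$ and $\sigma$ from left to right and viceversa (i.e. for $\eta:\big(U_{q,\Gamma'_+}(\mathfrak{b}_+)\big)_\sigma\otimes_{\Bbbk_q}U^\Psi_{q,\Gamma'_-}(\mathfrak{b}_-)\to\Bbbk_q$ with $\sigma$ a $2$-cocycle of $U_{q,\Gamma'_+}(\mathfrak{b}_+)$).
   Context: **Basic data.** $I=\{1,\dots,n\}$; $A=(a_{ij})_{i,j\in I}$ is an indecomposable Cartan matrix of finite type; $D=\mathrm{diag}(d_1,\dots,d_n)$ has positive coprime integer entries with $DA$ symmetric. $Q=\bigoplus_{i\in I}\mathbb{Z}\alpha_i$, $\mathbb{Q}Q:=\mathbb{Q}\otimes_{\mathbb{Z}}Q$, with the symmetric $\mathbb{Q}$-bilinear form $(\alpha_i,\alpha_j)=d_ia_{ij}$. $\Bbbk$ is a field of characteristic $0$, $q$ an indeterminate, $\Bbbk_q:=\bigcup_{m\ge1}\Bbbk(q^{1/m})$ (with compatible roots $q^{1/m}$), so $q^r\in\Bbbk_q$ for $r\in\mathbb{Q}$; $q_i:=q^{d_i}$. Lattices in $\mathbb{Q}Q$ are of rank $n$. $\mathfrak{so}_n(\mathbb{Q})$ is the set of antisymmetric rational $n\times n$ matrices.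 For $\Psi=(\psi_{ij})\in\mathfrak{so}_n(\mathbb{Q})$ let $\psi_\pm:\mathbb{Q}Q\to\mathbb{Q}Q$ be the linear maps $$\psi_+(\alpha_\ell)=\sum_{i,j\in I}\psi_{ij}a_{j\ell}d_i^{-1}\alpha_i,\qquad \psi_-(\alpha_\ell)=\sum_{i,j\in I}\psi_{ji}a_{j\ell}d_i^{-1}\alpha_i .$$ **Quantum Borel algebras.** For a lattice $\Gamma\supseteq Q$ in $\mathbb{Q}Q$, $U_{q,\Gamma}(\mathfrak{b}_+)$ is the $\Bbbk_q$-algebra with generators $E_i$ ($i\in I$), $K_\gamma$ ($\gamma\in\Gamma$) and relations $K_0=1$, $K_\gamma K_{\gamma'}=K_{\gamma+\gamma'}$, $K_\gamma E_jK_\gamma^{-1}=q^{(\gamma,\alpha_j)}E_j$, and for $i\ne j$ $\sum_{k=0}^{1-a_{ij}}(-1)^k\left[{1-a_{ij}\atop k}\right]_{q_i}E_i^{1-a_{ij}-k}E_jE_i^k=0$, where $\left[{m\atop k}\right]_v$ is the Gaussian binomial built from $[m]_v=\frac{v^m-v^{-m}}{v-v^{-1}}$. Similarly $U_{q,\Gamma}(\mathfrak{b}_-)$ has generators $F_i$, $K_\gamma$, with $K_\gamma F_jK_\gamma^{-1}=q^{-(\gamma,\alpha_j)}F_j$ and the same Serre relations for the $F_i$. Both are Hopf algebras: the $K_\gamma$ are group-like, $\Delta(E_i)=E_i\otimes1+K_{\alpha_i}\otimes E_i$, $\Delta(F_i)=F_i\otimes K_{\alpha_i}^{-1}+1\otimes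 F_i$, $\epsilon(E_i)=\epsilon(F_i)=0$. **Comultiplication twisting.** For $\Gamma\supseteq Q+\psi_+(Q)+\psi_-(Q)$ (as holds for $\Gamma'_\pm$), $U^\Psi_{q,\Gamma}(\mathfrak{b}_\pm)$ is the same algebra with the same counit and with the coproduct $\Delta^{(\Psi)}$ in which the $K_\gamma$ are group-like and $$\Delta^{(\Psi)}(E_\ell)=E_\ell\otimes K_{\psi_-(\alpha_\ell)}+K_{\alpha_\ell+\psi_+(\alpha_\ell)}\otimes E_\ell,\qquad \Delta^{(\Psi)}(F_\ell)=F_\ell\otimes K_{-\alpha_\ell-\psi_-(\alpha_\ell)}+K_{-\psi_+(\alpha_\ell)}\otimes F_\ell;$$ this is again a Hopf algebra. **Multiplication twisting.** $\mathcal{Z}^2(H,\Bbbk_q)$ is the set of all (normalized Hopf) $2$-cocycles of a Hopf algebra $H$, i.e. convolution invertible linear maps $\sigma:H\otimes H\to\Bbbk_q$ with $\sigma(b_{(1)},c_{(1)})\sigma(a,b_{(2)}c_{(2)})=\sigma(a_{(1)},b_{(1)})\sigma(a_{(2)}b_{(2)},c)$ and $\sigma(a,1)=\epsilon(a)=\sigma(1,a)$. $H_\sigma$ is the Hopf algebra with the coalgebra structure of $H$ and product $a\cdot_\sigma b=\sigma(a_{(1)},b_{(1)})\,a_{(2)}b_{(2)}\,\sigma^{-1}(a_{(3)},b_{(3)})$. A $2$-cocycle is toral if it is obtained from a bicharacter of the torus by composing with the Hopf algebra projection onto the group algebra of the torus that kills all $E_i$ (resp. $F_i$). The correspondence $\Psi\longleftrightarrow\sigma$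 is the bijection between $\mathfrak{so}_n(\mathbb{Q})$ and the set of $2$-cocycles of the form displayed in the claim. **Skew-Hopf pairing.** For Hopf algebras $H,K$ with bijective antipode $\mathcal{S}$, a linear map $\eta:H\otimes K\to\Bbbk_q$ is a skew-Hopf pairing if $\eta(h,k'k'')=\eta(h_{(1)},k')\eta(h_{(2)},k'')$, $\eta(h'h'',k)=\eta(h',k_{(2)})\eta(h'',k_{(1)})$, $\eta(h,1)=\epsilon(h)$, $\eta(1,k)=\epsilon(k)$, $\eta(\mathcal{S}^{\pm1}(h),k)=\eta(h,\mathcal{S}^{\mp1}(k))$. For lattices $\Lambda_\pm\supseteq Q$ in $\mathbb{Q}Q$, the standard pairing $\eta:U_{q,\Lambda_+}(\mathfrak{b}_+)\otimes U_{q,\Lambda_-}(\mathfrak{b}_-)\to\Bbbk_q$ is the unique skew-Hopf pairing (for the undeformed structures) with $\eta(K_\gamma,K_{\gamma'})=q^{-(\gamma,\gamma')}$, $\eta(E_i,F_j)=\frac{\delta_{ij}}{q_i^{-1}-q_i}$, $\eta(E_i,K_{\gamma'})=0=\eta(K_\gamma,F_j)$.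
   Formalization: The literal ''only if'' fails when Γ' ≠ Q (cocycles inflated from Γ'/Q), so the condition proved is: σ is torus-supported with σ(K_γ,K_γ') as prescribed by Ψ once γ or γ' is in Q; the literal equivalence is proved when Γ' = Q or σ has the displayed form for some Φ. *)

(* Defs.v *)
From HB Require Import structures.
From mathcomp Require Import all_boot all_order all_algebra.
From mathcomp Require Import boolp classical_sets.

Set Implicit Arguments.
Unset Strict Implicit.
Unset Printing Implicit Defensive.

Import Order.TTheory GRing.Theory Num.Theory.
Local Open Scope ring_scope.
Local Open Scope classical_set_scope.
Local Open Scope quotient_scope.

Definition bilin (K : fieldType) (V W X : lmodType K) (f : V -> W -> X) : Prop :=
  (forall (a : K) v v' w, f (a *: v + v') w = a *: f v w + f v' w) /\
  (forall (a : K) v w w', f v (a *: w + w') = a *: f v w + f v w').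

(* [tens V W] consists of the finite formal sums of pairs (v, w), two such sums
   being identified when no bilinear map distinguishes them. *)
Section Tensor.
Variables (K : fieldType) (V W : lmodType K).

Definition tsum (X : lmodType K) (f : V -> W -> X) (s : seq (V * W)) : X :=
  \sum_(p <- s) f p.1 p.2.

Definition tens_eqv (s t : seq (V * W)) : bool :=
  `[< forall (X : lmodType K) (f : V -> W -> X), bilin f ->
        tsum f s = tsum f t >].

Lemma tens_eqv_refl : reflexive tens_eqv.
Proof. by move=> s; apply/asboolP. Qed.
Lemma tens_eqv_sym : symmetric tens_eqv.
Proof.
by move=> s t; apply/idP/idP => /asboolP h; apply/asboolP => X f bf;
  rewrite h.
Qed.
Lemma tens_eqv_trans : transitive tens_eqv.
Proof.
move=> s t u /asboolP h1 /asboolP h2; apply/asboolP => X f bf.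
by rewrite h1 // h2.
Qed.

Canonical tens_equiv := EquivRel tens_eqv tens_eqv_refl tens_eqv_sym
  tens_eqv_trans.

Definition tens : Type := {eq_quot tens_equiv}.
HB.instance Definition _ := Choice.on tens.

Definition tclass (s : seq (V * W)) : tens := \pi_({eq_quot tens_equiv}) s.
Definition sweedler (t : tens) : seq (V * W) :=
  repr (t : {eq_quot tens_equiv}).

Lemma sweedlerK : cancel sweedler tclass.
Proof. exact: reprK. Qed.

Lemma tclassP s t : (forall (X : lmodType K) (f : V -> W -> X), bilin f ->
  tsum f s = tsum f t) <-> tclass s = tclass t.
Proof.
split=> [h|]; first by apply/eqmodP/asboolP.
by move/eqmodP/asboolP.
Qed.

Lemma tsum_sweedler (X : lmodType K) (f : V -> W -> X) s :
  bilin f -> tsum f (sweedler (tclass s)) = tsum f s.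
Proof.
move=> bf; have /tclassP h : tclass (sweedler (tclass s)) = tclass s.
  by rewrite sweedlerK.
exact: h.
Qed.

Lemma tens_ext (x y : tens) : (forall (X : lmodType K) (f : V -> W -> X),
  bilin f -> tsum f (sweedler x) = tsum f (sweedler y)) -> x = y.
Proof. by move=> h; rewrite -[x]sweedlerK -[y]sweedlerK; apply/tclassP. Qed.

Lemma tsum_cat (X : lmodType K) (f : V -> W -> X) s t :
  tsum f (s ++ t) = tsum f s + tsum f t.
Proof. exact: big_cat. Qed.

Lemma bilin0l (X : lmodType K) (f : V -> W -> X) w : bilin f -> f 0 w = 0.
Proof.
case=> h _; have := h (-1) 0 0 w.
by rewrite scaler0 addr0 scaleN1r addNr.
Qed.

Lemma bilinZl (X : lmodType K) (f : V -> W -> X) a v w : bilin f ->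
  f (a *: v) w = a *: f v w.
Proof. by move=> bf; rewrite -[a *: v]addr0 bf.1 (bilin0l _ bf) addr0. Qed.

Definition sscale (a : K) (s : seq (V * W)) : seq (V * W) :=
  [seq (a *: p.1, p.2) | p <- s].

Lemma tsum_sscale (X : lmodType K) (f : V -> W -> X) a s : bilin f ->
  tsum f (sscale a s) = a *: tsum f s.
Proof.
move=> bf; rewrite /tsum big_map scaler_sumr.
by apply: eq_bigr => p _; rewrite bilinZl.
Qed.

Definition tzero : tens := tclass [::].
Definition tadd (x y : tens) : tens := tclass (sweedler x ++ sweedler y).
Definition tscale (a : K) (x : tens) : tens := tclass (sscale a (sweedler x)).
Definition topp (x : tens) : tens := tscale (-1) x.

Lemma tsum_tadd (X : lmodType K) (f : V -> W -> X) x y : bilin f ->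
  tsum f (sweedler (tadd x y)) = tsum f (sweedler x) + tsum f (sweedler y).
Proof. by move=> bf; rewrite tsum_sweedler // tsum_cat. Qed.
Lemma tsum_tscale (X : lmodType K) (f : V -> W -> X) a x : bilin f ->
  tsum f (sweedler (tscale a x)) = a *: tsum f (sweedler x).
Proof. by move=> bf; rewrite tsum_sweedler // tsum_sscale. Qed.
Lemma tsum_tzero (X : lmodType K) (f : V -> W -> X) : bilin f ->
  tsum f (sweedler tzero) = 0.
Proof. by move=> bf; rewrite tsum_sweedler // /tsum big_nil. Qed.

Lemma taddA : associative tadd.
Proof.
by move=> x y z; apply: tens_ext => X f bf; rewrite !tsum_tadd // addrA.
Qed.
Lemma taddC : commutative tadd.
Proof.
by move=> x y; apply: tens_ext => X f bf; rewrite !tsum_tadd // addrC.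
Qed.
Lemma tadd0 : left_id tzero tadd.
Proof.
move=> x; apply: tens_ext => X f bf.
by rewrite !tsum_tadd // tsum_tzero // add0r.
Qed.
Lemma taddN : left_inverse tzero topp tadd.
Proof.
move=> x; apply: tens_ext => X f bf.
by rewrite tsum_tadd // tsum_tzero // tsum_tscale // scaleN1r addNr.
Qed.

HB.instance Definition _ := GRing.isZmodule.Build tens taddA taddC tadd0 taddN.

Lemma tscaleA a b x : tscale a (tscale b x) = tscale (a * b) x.
Proof.
by apply: tens_ext => X f bf; rewrite !tsum_tscale // scalerA.
Qed.
Lemma tscale1 : left_id 1 tscale.
Proof. by move=> x; apply: tens_ext => X f bf; rewrite tsum_tscale // scale1r. Qed.
Lemma tscaleDr : right_distributive tscale +%R.
Proof.
move=> a x y; apply: tens_ext => X f bf.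
by rewrite tsum_tadd // !tsum_tscale // tsum_tadd // scalerDr.
Qed.
Lemma tscaleDl x : {morph tscale^~ x : a b / a + b}.
Proof.
move=> a b; apply: tens_ext => X f bf.
by rewrite tsum_tadd // !tsum_tscale // scalerDl.
Qed.

HB.instance Definition _ := GRing.Zmodule_isLmodule.Build K tens
  tscaleA tscale1 tscaleDr tscaleDl.

Lemma tsum_lin (X : lmodType K) (f : V -> W -> X) a (x y : tens) : bilin f ->
  tsum f (sweedler (a *: x + y))
  = a *: tsum f (sweedler x) + tsum f (sweedler y).
Proof. by move=> bf; rewrite -tsum_tscale // -tsum_tadd. Qed.

Definition pure (v : V) (w : W) : tens := tclass [:: (v, w)].

Lemma pure_bilin : bilin pure.
Proof.
split=> *; apply: tens_ext => X f bf;
  rewrite tsum_lin // !tsum_sweedler // /tsum !big_seq1 /=.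
- by rewrite bf.1.
- by rewrite bf.2.
Qed.

Definition tlift (X : lmodType K) (f : V -> W -> X) (t : tens) : X :=
  tsum f (sweedler t).

Lemma tlift_pure (X : lmodType K) (f : V -> W -> X) v w : bilin f ->
  tlift f (pure v w) = f v w.
Proof. by move=> bf; rewrite /tlift tsum_sweedler // /tsum big_seq1. Qed.

Lemma tlift_linear (X : lmodType K) (f : V -> W -> X) : bilin f ->
  linear (tlift f).
Proof.
by move=> bf a x y; rewrite /tlift tsum_lin.
Qed.

Lemma tens_sum (t : tens) : t = \sum_(p <- sweedler t) pure p.1 p.2.
Proof.
apply: tens_ext => X f bf; rewrite {1}/tsum.
elim: (sweedler t) => [|p s IH]; rewrite ?big_nil ?big_cons.
  by rewrite [RHS]tsum_tzero.
by rewrite IH -[pure _ _]scale1r tsum_lin // scale1r -[in RHS]/(tlift f _)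
  tlift_pure.
Qed.

End Tensor.

(* The multiplication is part of the data, because a 2-cocycle deforms it on a
   fixed underlying vector space.  The element [pure h1 h2] is $h_1\otimes h_2$,
   and a sum over [p <- sw comul x] is the sum over $x_{(1)}\otimes x_{(2)}$ with
   $x_{(1)}$ = [p.1] and $x_{(2)}$ = [p.2]. *)

Notation sw comul x := (sweedler (comul x)).

Section Hopf.
Variables (K : fieldType) (V : lmodType K).

Record hopf_axioms (mul : V -> V -> V) (one : V) (comul : V -> tens V V)
    (counit : V -> K) (anti : V -> V) : Prop := HopfAxioms {
  hopf_mul_bilin : bilin mul;
  hopf_mulA : associative mul;
  hopf_mul1l : left_id one mul;
  hopf_mul1r : right_id one mul;
  hopf_comul_lin : linear comul;
  hopf_counit_lin : scalar counit;
  hopf_coassoc : forall x : V,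
    \sum_(p <- sw comul x) \sum_(r <- sw comul p.1) pure (pure r.1 r.2) p.2
    = \sum_(p <- sw comul x) \sum_(r <- sw comul p.2) pure (pure p.1 r.1) r.2;
  hopf_counitl : forall x : V, \sum_(p <- sw comul x) counit p.1 *: p.2 = x;
  hopf_counitr : forall x : V, \sum_(p <- sw comul x) counit p.2 *: p.1 = x;
  hopf_comulM : forall x y : V, comul (mul x y)
    = \sum_(p <- sw comul x) \sum_(r <- sw comul y)
        pure (mul p.1 r.1) (mul p.2 r.2);
  hopf_comul1 : comul one = pure one one;
  hopf_counitM : forall x y : V, counit (mul x y) = counit x * counit y;
  hopf_counit1 : counit one = 1;
  hopf_anti_lin : linear anti;
  hopf_antil : forall x : V,
    \sum_(p <- sw comul x) mul (anti p.1) p.2 = counit x *: one;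
  hopf_antir : forall x : V,
    \sum_(p <- sw comul x) mul p.1 (anti p.2) = counit x *: one }.

Record hopf := Hopf {
  hmul : V -> V -> V;
  hone : V;
  hcomul : V -> tens V V;
  hcounit : V -> K;
  hanti : V -> V;
  hopfP : hopf_axioms hmul hone hcomul hcounit hanti }.

(* A normalized Hopf 2-cocycle together with its (unique) convolution inverse. *)
Record two_cocycle (H : hopf) := TwoCocycle {
  coc :> V -> V -> K;
  coc_inv : V -> V -> K;
  coc_bilin : bilin (coc : V -> V -> K^o);
  coc_inv_bilin : bilin (coc_inv : V -> V -> K^o);
  coc_invr : forall a b : V,
    \sum_(p <- sw (hcomul H) a) \sum_(r <- sw (hcomul H) b)
      coc p.1 r.1 * coc_inv p.2 r.2 = hcounit H a * hcounit H b;
  coc_invl : forall a b : V,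
    \sum_(p <- sw (hcomul H) a) \sum_(r <- sw (hcomul H) b)
      coc_inv p.1 r.1 * coc p.2 r.2 = hcounit H a * hcounit H b;
  coc_eq : forall a b c : V,
    \sum_(p <- sw (hcomul H) b) \sum_(r <- sw (hcomul H) c)
      coc p.1 r.1 * coc a (hmul H p.2 r.2)
    = \sum_(p <- sw (hcomul H) a) \sum_(r <- sw (hcomul H) b)
      coc p.1 r.1 * coc (hmul H p.2 r.2) c;
  coc_norml : forall a : V, coc (hone H) a = hcounit H a;
  coc_normr : forall a : V, coc a (hone H) = hcounit H a }.

(* $a\cdot_\sigma b=\sigma(a_{(1)},b_{(1)})\,a_{(2)}b_{(2)}\,
   \sigma^{-1}(a_{(3)},b_{(3)})$, with $a_{(1)}$ = [p.1], $a_{(2)}$ = [p'.1],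
   $a_{(3)}$ = [p'.2], and similarly for b with [r], [r']. *)
Definition coc_mul (H : hopf) (s : two_cocycle H) (a b : V) : V :=
  \sum_(p <- sw (hcomul H) a) \sum_(p' <- sw (hcomul H) p.2)
  \sum_(r <- sw (hcomul H) b) \sum_(r' <- sw (hcomul H) r.2)
    (s p.1 r.1 * coc_inv s p'.2 r'.2) *: hmul H p'.1 r'.1.

(* [L] is the Hopf algebra $H_\sigma$; its antipode is then determined. *)
Record is_cocycle_deformation (H : hopf) (s : two_cocycle H) (L : hopf) : Prop :=
  IsCocycleDeformation {
  cdef_mul : forall a b : V, hmul L a b = coc_mul s a b;
  cdef_one : hone L = hone H;
  cdef_comul : forall a : V, hcomul L a = hcomul H a;
  cdef_counit : forall a : V, hcounit L a = hcounit H a }.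

End Hopf.

Section Pairing.
Variables (K : fieldType) (V W : lmodType K) (H : hopf V) (L : hopf W).
Variable eta : V -> W -> K.

Definition coproduct_dual_to_product : Prop := forall (h : V) (k k' : W),
  eta h (hmul L k k') = \sum_(p <- sw (hcomul H) h) eta p.1 k * eta p.2 k'.

Definition product_dual_to_coproduct : Prop := forall (h h' : V) (k : W),
  eta (hmul H h h') k = \sum_(p <- sw (hcomul L) k) eta h p.2 * eta h' p.1.

Record skew_hopf_pairing : Prop := SkewHopfPairing {
  skew_bilin : bilin (eta : V -> W -> K^o);
  skew_mulr : coproduct_dual_to_product;
  skew_mull : product_dual_to_coproduct;
  skew_oner : forall h : V, eta h (hone L) = hcounit H h;
  skew_onel : forall k : W, eta (hone H) k = hcounit L k;
  skew_anti : exists (antiHi : V -> V) (antiLi : W -> W),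
    [/\ cancel (hanti H) antiHi, cancel antiHi (hanti H),
        cancel (hanti L) antiLi & cancel antiLi (hanti L)] /\
    (forall h k, eta (hanti H h) k = eta h (antiLi k)) /\
    (forall h k, eta (antiHi h) k = eta h (hanti L k)) }.

End Pairing.

Inductive ncterm (K G : Type) : Type :=
| NCconst of K
| NCgen of G
| NCadd of ncterm K G & ncterm K G
| NCmul of ncterm K G & ncterm K G.

HB.instance Definition _ K G := gen_eqMixin (ncterm K G).
HB.instance Definition _ K G := gen_choiceMixin (ncterm K G).

Fixpoint nceval (K : fieldType) (G : Type) (B : algType K) (f : G -> B)
    (t : ncterm K G) : B :=
  match t with
  | NCconst c => c%:A
  | NCgen g => f g
  | NCadd t1 t2 => nceval f t1 + nceval f t2
  | NCmul t1 t2 => nceval f t1 * nceval f t2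
  end.

(* Relations between generators [G], as the predicate "the family f of elements
   of the algebra B satisfies the relations".  Since [algType] excludes the zero
   algebra, the presented algebra is required not to collapse. *)
Record presentation (K : fieldType) (G : Type) := Presentation {
  prels :> forall B : algType K, (G -> B) -> Prop;
  pconsistent : exists (B : algType K) (f : G -> B), prels f }.

(* Noncommutative expressions in the generators, modulo the identities that the
   relations force in every algebra. *)
Section Presented.
Variables (K : fieldType) (G : Type) (P : presentation K G).

Definition nc_eqv (t u : ncterm K G) : bool :=
  `[< forall (B : algType K) (f : G -> B), P B f -> nceval f t = nceval f u >].

Lemma nc_eqv_refl : reflexive nc_eqv.
Proof. by move=> s; apply/asboolP. Qed.
Lemma nc_eqv_sym : symmetric nc_eqv.
Proof.
by move=> s t; apply/idP/idP => /asboolP h; apply/asboolP => B f bf;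
  rewrite h.
Qed.
Lemma nc_eqv_trans : transitive nc_eqv.
Proof.
move=> s t u /asboolP h1 /asboolP h2; apply/asboolP => B f bf.
by rewrite h1 // h2.
Qed.

Canonical nc_equiv := EquivRel nc_eqv nc_eqv_refl nc_eqv_sym nc_eqv_trans.

Definition presented : Type := {eq_quot nc_equiv}.
HB.instance Definition _ := Choice.on presented.

Definition pclass (t : ncterm K G) : presented := \pi_({eq_quot nc_equiv}) t.
Definition prepr (x : presented) : ncterm K G := repr (x : {eq_quot nc_equiv}).

Lemma preprK : cancel prepr pclass.
Proof. exact: reprK. Qed.

Lemma pclassP t u : (forall (B : algType K) (f : G -> B), P B f ->
  nceval f t = nceval f u) <-> pclass t = pclass u.
Proof.
split=> [h|]; first by apply/eqmodP/asboolP.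
by move/eqmodP/asboolP.
Qed.

Definition plift (B : algType K) (f : G -> B) (x : presented) : B :=
  nceval f (prepr x).

Lemma plift_class (B : algType K) (f : G -> B) t : P B f ->
  plift f (pclass t) = nceval f t.
Proof.
move=> Pf; have /pclassP h : pclass (prepr (pclass t)) = pclass t.
  by rewrite preprK.
exact: h.
Qed.

Lemma presented_ext x y : (forall (B : algType K) (f : G -> B), P B f ->
  plift f x = plift f y) -> x = y.
Proof. by move=> h; rewrite -[x]preprK -[y]preprK; apply/pclassP. Qed.

Definition pone : presented := pclass (NCconst G 1).
Definition pzero : presented := pclass (NCconst G 0).
Definition padd x y : presented := pclass (NCadd (prepr x) (prepr y)).
Definition pmul x y : presented := pclass (NCmul (prepr x) (prepr y)).
Definition pscale c x : presented := pclass (NCmul (NCconst G c) (prepr x)).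
Definition popp x : presented := pscale (-1) x.
Definition pgen (g : G) : presented := pclass (NCgen K g).

Section Lift.
Variables (B : algType K) (f : G -> B) (Pf : P B f).
Lemma plift0 : plift f pzero = 0.
Proof. by rewrite plift_class //= scale0r. Qed.
Lemma plift1 : plift f pone = 1.
Proof. by rewrite plift_class //= scale1r. Qed.
Lemma pliftD x y : plift f (padd x y) = plift f x + plift f y.
Proof. by rewrite plift_class. Qed.
Lemma pliftM x y : plift f (pmul x y) = plift f x * plift f y.
Proof. by rewrite plift_class. Qed.
Lemma pliftZ c x : plift f (pscale c x) = c *: plift f x.
Proof. by rewrite plift_class //= mulr_algl. Qed.
Lemma pliftN x : plift f (popp x) = - plift f x.
Proof. by rewrite pliftZ scaleN1r. Qed.
Lemma plift_gen g : plift f (pgen g) = f g.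
Proof. by rewrite plift_class. Qed.
Definition pliftE :=
  (plift0, plift1, pliftD, pliftM, pliftZ, pliftN, plift_gen).
End Lift.

Lemma paddA : associative padd.
Proof.
by move=> x y z; apply: presented_ext => B f Pf; rewrite !(pliftE Pf) addrA.
Qed.
Lemma paddC : commutative padd.
Proof.
by move=> x y; apply: presented_ext => B f Pf; rewrite !(pliftE Pf) addrC.
Qed.
Lemma padd0 : left_id pzero padd.
Proof.
by move=> x; apply: presented_ext => B f Pf; rewrite !(pliftE Pf) add0r.
Qed.
Lemma paddN : left_inverse pzero popp padd.
Proof.
by move=> x; apply: presented_ext => B f Pf; rewrite !(pliftE Pf) addNr.
Qed.
HB.instance Definition _ :=
  GRing.isZmodule.Build presented paddA paddC padd0 paddN.

Lemma plift_add (B : algType K) (f : G -> B) (Pf : P B f) (x y : presented) :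
  plift f (x + y) = plift f x + plift f y.
Proof. exact: pliftD. Qed.

Lemma pmulA : associative pmul.
Proof.
by move=> x y z; apply: presented_ext => B f Pf; rewrite !(pliftE Pf) mulrA.
Qed.
Lemma pmul1 : left_id pone pmul.
Proof.
by move=> x; apply: presented_ext => B f Pf; rewrite !(pliftE Pf) mul1r.
Qed.
Lemma pmulr1 : right_id pone pmul.
Proof.
by move=> x; apply: presented_ext => B f Pf; rewrite !(pliftE Pf) mulr1.
Qed.
Lemma pmulDl : left_distributive pmul +%R.
Proof.
by move=> x y z; apply: presented_ext => B f Pf; rewrite !(pliftM Pf, plift_add Pf) mulrDl.
Qed.
Lemma pmulDr : right_distributive pmul +%R.
Proof.
by move=> x y z; apply: presented_ext => B f Pf; rewrite !(pliftM Pf, plift_add Pf) mulrDr.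
Qed.
Lemma pone_neq0 : pone != 0.
Proof.
have [B [f Pf]] := pconsistent P; apply/eqP => /(congr1 (plift f)).
by rewrite !(pliftE Pf) => /eqP; rewrite oner_eq0.
Qed.
HB.instance Definition _ := GRing.Zmodule_isNzRing.Build presented
  pmulA pmul1 pmulr1 pmulDl pmulDr pone_neq0.

Lemma plift_mul (B : algType K) (f : G -> B) (Pf : P B f) (x y : presented) :
  plift f (x * y) = plift f x * plift f y.
Proof. exact: pliftM. Qed.

Lemma pscaleA a b x : pscale a (pscale b x) = pscale (a * b) x.
Proof. by apply: presented_ext => B f Pf; rewrite !(pliftZ Pf) scalerA. Qed.
Lemma pscale1 : left_id 1 pscale.
Proof.
by move=> x; apply: presented_ext => B f Pf; rewrite !(pliftE Pf) scale1r.
Qed.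
Lemma pscaleDr : right_distributive pscale +%R.
Proof.
by move=> a x y; apply: presented_ext => B f Pf; rewrite !(pliftZ Pf, plift_add Pf) scalerDr.
Qed.
Lemma pscaleDl x : {morph pscale^~ x : a b / a + b}.
Proof.
by move=> a b; apply: presented_ext => B f Pf; rewrite (plift_add Pf) !(pliftZ Pf) scalerDl.
Qed.
HB.instance Definition _ := GRing.Zmodule_isLmodule.Build K presented
  pscaleA pscale1 pscaleDr pscaleDl.

Lemma plift_scale (B : algType K) (f : G -> B) (Pf : P B f) a (x : presented) :
  plift f (a *: x) = a *: plift f x.
Proof. exact: pliftZ. Qed.

Lemma pscaleAl a (x y : presented) : a *: (x * y) = (a *: x) * y.
Proof.
apply: presented_ext => B f Pf.
by rewrite !(plift_scale Pf, plift_mul Pf) scalerAl.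
Qed.
HB.instance Definition _ := GRing.Lmodule_isLalgebra.Build K presented pscaleAl.
Lemma pscaleAr a (x y : presented) : a *: (x * y) = x * (a *: y).
Proof.
apply: presented_ext => B f Pf.
by rewrite !(plift_scale Pf, plift_mul Pf) scalerAr.
Qed.
HB.instance Definition _ := GRing.Lalgebra_isAlgebra.Build K presented pscaleAr.

Section LiftMorphism.
Variables (B : algType K) (f : G -> B) (Pf : P B f).
Lemma plift_linear : linear (plift f).
Proof. by move=> a x y; rewrite (plift_add Pf) (plift_scale Pf). Qed.
Lemma plift_multiplicative : monoid_morphism (plift f).
Proof. by split=> [|x y]; [exact: plift1 | exact: pliftM]. Qed.

Lemma plift_lrmorphism :
  exists phi : {lrmorphism presented -> B}, forall x, phi x = plift f x.
Proof.
pose F := GRing.isLinear.Build _ _ _ _ _ plift_linear.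
pose M := GRing.isMonoidMorphism.Build _ _ _ plift_multiplicative.
by exists (HB.pack (plift f) F M : {lrmorphism presented -> B}).
Qed.
End LiftMorphism.

End Presented.

(* [qroot_field k K]: K is $\Bbbk_q=\bigcup_{m\ge1}\Bbbk(q^{1/m})$ over $\Bbbk$ = k,
   with the compatible family of roots [qpow r] = $q^r$. *)
Record qroot_field (k K : fieldType) := QRootField {
  kincl : {rmorphism k -> K};
  qpow :> rat -> K;
  qpow0 : qpow 0 = 1;
  qpowD : forall r s : rat, qpow (r + s) = qpow r * qpow s;
  q_transcendental : forall p : {poly k},
    p != 0 -> (map_poly kincl p).[qpow 1] != 0;
  q_generates : forall x : K, exists (m : nat) (p r : {poly k}),
    [/\ (0 < m)%N, (map_poly kincl r).[qpow m%:R^-1] != 0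
      & x = (map_poly kincl p).[qpow m%:R^-1]
            / (map_poly kincl r).[qpow m%:R^-1]] }.

Section CartanData.
Variables (n : nat) (A : 'M[int]_n) (d : 'I_n -> nat).

Definition AQ : 'M[rat]_n := map_mx intr A.

(* Vectors of $\mathbb{Q}Q$ are row vectors of coordinates in the simple roots. *)
Definition sroot (i : 'I_n) : 'rV[rat]_n := delta_mx 0 i.

Definition root_form (v w : 'rV[rat]_n) : rat :=
  \sum_i \sum_j v 0 i * w 0 j * ((d i)%:R * AQ i j).

Record finite_cartan_datum : Prop := FiniteCartanDatum {
  cartan_rank_gt0 : (0 < n)%N;
  cartan_diag : forall i, A i i = 2;
  cartan_offdiag : forall i j, i != j -> A i j <= 0;
  cartan_d_gt0 : forall i, (0 < d i)%N;
  cartan_d_coprime : \big[gcdn/0%N]_i d i = 1%N;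
  cartan_sym : forall i j, (d i)%:Z * A i j = (d j)%:Z * A j i;
  cartan_posdef : forall v : 'rV[rat]_n, v != 0 -> 0 < root_form v v;
  cartan_indecomposable : forall J : {set 'I_n}, 
      J != finset.set0 -> J != [set: 'I_n]%SET ->
    exists i j, [/\ i \in J, j \notin J & A i j != 0] }.

Definition root_lattice : set 'rV[rat]_n :=
  [set v | exists c : 'rV[int]_n, v = map_mx intr c].

Definition is_lattice (Gam : set 'rV[rat]_n) : Prop :=
  exists B : 'M[rat]_n, B \in unitmx /\
    Gam = [set v | exists c : 'rV[int]_n, v = map_mx intr c *m B].

Definition antisym (Psi : 'M[rat]_n) : Prop := Psi^T = - Psi.

Definition psi_plus (Psi : 'M[rat]_n) (v : 'rV[rat]_n) : 'rV[rat]_n :=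
  \sum_l \sum_i \sum_j
    (v 0 l * (Psi i j * AQ j l * (d i)%:R^-1)) *: sroot i.

Definition psi_minus (Psi : 'M[rat]_n) (v : 'rV[rat]_n) : 'rV[rat]_n :=
  \sum_l \sum_i \sum_j
    (v 0 l * (Psi j i * AQ j l * (d i)%:R^-1)) *: sroot i.

(* $(\mathrm{id}+\psi_+)(\Gamma_1)-\psi_-(\Gamma_2)+Q$ *)
Definition twisted_lattice (Psi : 'M[rat]_n) (Gam1 Gam2 : set 'rV[rat]_n) :
    set 'rV[rat]_n :=
  [set v | exists u w c, [/\ Gam1 u, Gam2 w, root_lattice c
    & v = u + psi_plus Psi u - psi_minus Psi w + c]].

(* The $\mathbb{Q}$-bilinear form with $(\alpha_i,\alpha_j)\mapsto
   (A^T\Psi A)_{ij}$. *)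
Definition twist_form (Psi : 'M[rat]_n) (v w : 'rV[rat]_n) : rat :=
  (v *m (AQ^T *m Psi *m AQ) *m w^T) 0 0.

End CartanData.

Definition qint (K : fieldType) (v : K) (m : nat) : K :=
  (v ^+ m - v ^- m) / (v - v^-1).

Definition qfact (K : fieldType) (v : K) (m : nat) : K :=
  \prod_(1 <= j < m.+1) qint v j.

Definition qbinom (K : fieldType) (v : K) (m k : nat) : K :=
  qfact v m / (qfact v k * qfact v (m - k)).

(* The sign [s] is [true] for $\mathfrak{b}_+$ (generators $E_i$) and [false] for
   $\mathfrak{b}_-$ (generators $F_i$). *)
Section Borel.
Variables (K : fieldType) (q : rat -> K).
Variables (n : nat) (A : 'M[int]_n) (d : 'I_n -> nat).
Variables (Gam : set 'rV[rat]_n) (s : bool).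

Definition bsign : rat := if s then 1 else -1.

Inductive borel_gen : Type :=
| GenK of {v : 'rV[rat]_n | v \in Gam}
| GenX of 'I_n.

Record borel_relations (B : algType K) (f : borel_gen -> B) : Prop :=
  BorelRelations {
  borel_K0 : forall g, val g = 0 -> f (GenK g) = 1;
  borel_KM : forall g h gh, val gh = val g + val h ->
    f (GenK g) * f (GenK h) = f (GenK gh);
  borel_KX : forall g h j, val h = - val g ->
    f (GenK g) * f (GenX j) * f (GenK h)
    = q (bsign * root_form A d (val g) (sroot j)) *: f (GenX j);
  borel_serre : forall i j, i != j ->
    let m := `|(1 - A i j)%R|%N in
    \sum_(k < m.+1) ((-1) ^+ k * qbinom (q (d i)%:R) m k) *:
      (f (GenX i) ^+ (m - k) * f (GenX j) * f (GenX i) ^+ k) = 0 }.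

Lemma borel_consistent :
  exists (B : algType K) (f : borel_gen -> B), borel_relations f.
Proof.
exists K^o, (fun g => if g is GenK _ then 1 else 0); split=> //=.
- by move=> *; rewrite mulr1.
- by move=> *; rewrite mulr0 mul0r scaler0.
- by move=> i j _; apply: big1 => k _; rewrite mulr0 mul0r scaler0.
Qed.

Definition borel_pres : presentation K borel_gen :=
  Presentation borel_consistent.

Definition borel : algType K := presented borel_pres.

Definition bX (i : 'I_n) : borel := pgen borel_pres (GenX i).

(* $K_v$, with the junk value 0 when v is not in the lattice. *)
Definition bK (v : 'rV[rat]_n) : borel :=
  oapp (fun g => pgen borel_pres (GenK g)) 0 (insub v).

Lemma borel_holds : borel_relations (pgen borel_pres).
Proof.
have mor B f (Pf : borel_pres B f) : monoid_morphism (plift (P := borel_pres) f).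
  exact: plift_multiplicative.
split.
- move=> g g0; apply: presented_ext => B f Pf.
  by rewrite plift_gen // (plift1 Pf) (borel_K0 Pf).
- move=> g h gh e; apply: presented_ext => B f Pf.
  by rewrite (mor _ _ Pf).2 !plift_gen // (borel_KM Pf e).
- move=> g h j e; apply: presented_ext => B f Pf.
  by rewrite (pliftZ Pf) !(mor _ _ Pf).2 !plift_gen // (borel_KX Pf _ e).
- move=> i j ij m; apply: presented_ext => B f Pf.
  have [phi phiE] := plift_lrmorphism (P := borel_pres) Pf.
  rewrite -!phiE linear_sum linear0 /= -[RHS](borel_serre Pf ij).
  apply: eq_bigr => k _; rewrite phiE (plift_scale Pf) -phiE.
  by rewrite !rmorphM !rmorphXn /= !phiE !plift_gen.
Qed.

Lemma borel_universal (B : algType K) (f : borel_gen -> B) :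
  borel_relations f -> exists phi : {lrmorphism borel -> B},
    (forall g, phi (pgen borel_pres g) = f g) /\
    (forall phi' : {lrmorphism borel -> B},
       (forall g, phi' (pgen borel_pres g) = f g) -> phi' =1 phi).
Proof.
move=> Pf.
have [phi phiE] := plift_lrmorphism (P := borel_pres) Pf.
exists phi; split=> [g|phi' h x]; first by rewrite phiE plift_gen.
rewrite phiE -[x]preprK plift_class //.
elim: (prepr x) => [c|g|t IHt u IHu|t IHt u IHu] /=.
- have -> : pclass borel_pres (NCconst _ c) = c%:A.
    by apply: presented_ext => C g Pg; rewrite (pliftZ Pg) (plift1 Pg) plift_class.
  by rewrite linearZ rmorph1.
- exact: h.
- rewrite -IHt -IHu -raddfD; congr (phi' _).
  by apply: presented_ext => C g Pg; rewrite (pliftD Pg) !plift_class.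
- rewrite -IHt -IHu -rmorphM; congr (phi' _).
  by apply: presented_ext => C g Pg; rewrite (pliftM Pg) !plift_class.
Qed.

(* $\Delta^{(\Psi)}(X_l)=X_l\otimes K_{r_l}+K_{l_l}\otimes X_l$ *)
Definition right_leg (Psi : 'M[rat]_n) (l : 'I_n) : 'rV[rat]_n :=
  if s then psi_minus A d Psi (sroot l)
  else - sroot l - psi_minus A d Psi (sroot l).

Definition left_leg (Psi : 'M[rat]_n) (l : 'I_n) : 'rV[rat]_n :=
  if s then sroot l + psi_plus A d Psi (sroot l)
  else - psi_plus A d Psi (sroot l).

(* [H] is the Hopf algebra $U^\Psi_{q,\Gamma}(\mathfrak{b}_\pm)$; the undeformed
   $U_{q,\Gamma}(\mathfrak{b}_\pm)$ is the case [Psi = 0].  Since $\Delta$ and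
   $\epsilon$ are algebra morphisms, their values on generators determine them,
   and they determine the antipode. *)
Record is_borel_hopf (Psi : 'M[rat]_n) (H : hopf borel) : Prop := IsBorelHopf {
  bhopf_mul : forall x y : borel, hmul H x y = x * y;
  bhopf_one : hone H = 1;
  bhopf_comulK : forall v, v \in Gam -> hcomul H (bK v) = pure (bK v) (bK v);
  bhopf_comulX : forall l, hcomul H (bX l)
    = pure (bX l) (bK (right_leg Psi l)) + pure (bK (left_leg Psi l)) (bX l);
  bhopf_counitK : forall v, v \in Gam -> hcounit H (bK v) = 1;
  bhopf_counitX : forall l, hcounit H (bX l) = 0 }.

(* The Hopf projection onto the torus, as an endomorphism with image the span of
   the $K_\gamma$. *)
Definition torus_projection (pi : {lrmorphism borel -> borel}) : Prop :=
  (forall v, v \in Gam -> pi (bK v) = bK v) /\ (forall i, pi (bX i) = 0).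

Definition factors_through_torus (sig : borel -> borel -> K) : Prop :=
  exists2 pi : {lrmorphism borel -> borel}, torus_projection pi
    & forall x y, sig x y = sig (pi x) (pi y).

(* The toral 2-cocycle of Psi: the bicharacter of the torus
   $(\gamma,\gamma')\mapsto q^{-\beta(\gamma,\gamma')}$ composed with the
   projection, where $\beta$ is the $\mathbb{Q}$-bilinear form with
   $\beta(\alpha_i,\alpha_j)=(A^T\Psi A)_{ij}$. *)
Definition toral_cocycle_of (Psi : 'M[rat]_n) (sig : borel -> borel -> K) : Prop :=
  factors_through_torus sig /\
  (forall v w, v \in Gam -> w \in Gam ->
     sig (bK v) (bK w) = q (- twist_form A Psi v w)).

(* The same, with the value on $(K_\gamma,K_{\gamma'})$ left free when neither
   $\gamma$ nor $\gamma'$ lies in the root lattice.  These values are not seen by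
   the deformed product: multiplying a cocycle by one inflated from the finite
   group $\Gamma/Q$ along $X_i\mapsto 0$ leaves $\cdot_\sigma$ unchanged. *)
Definition corresponding_cocycle (Psi : 'M[rat]_n) (sig : borel -> borel -> K) :
    Prop :=
  factors_through_torus sig /\
  (forall v w, v \in Gam -> w \in Gam ->
     v \in @root_lattice n \/ w \in @root_lattice n ->
     sig (bK v) (bK w) = q (- twist_form A Psi v w)).

End Borel.

Section StandardPairing.
Variables (K : fieldType) (q : rat -> K).
Variables (n : nat) (A : 'M[int]_n) (d : 'I_n -> nat).
Variables (Gp Gm : set 'rV[rat]_n).

Local Notation Up := (borel q A d Gp true).
Local Notation Um := (borel q A d Gm false).

Record is_standard_pairing (Hp : hopf Up) (Hm : hopf Um) (eta : Up -> Um -> K) :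
    Prop := IsStandardPairing {
  std_skew : skew_hopf_pairing Hp Hm eta;
  std_KK : forall v w, v \in Gp -> w \in Gm ->
    eta (bK _ _ _ _ _ v) (bK _ _ _ _ _ w) = q (- root_form A d v w);
  std_EF : forall i j, eta (bX _ _ _ _ _ i) (bX _ _ _ _ _ j)
    = (i == j)%:R / ((q (d i)%:R)^-1 - q (d i)%:R);
  std_EK : forall i w, w \in Gm -> eta (bX _ _ _ _ _ i) (bK _ _ _ _ _ w) = 0;
  std_KF : forall v j, v \in Gp -> eta (bK _ _ _ _ _ v) (bX _ _ _ _ _ j) = 0 }.

End StandardPairing.

(* Main.v *)
Require Import Defs.
From HB Require Import structures.
From mathcomp Require Import all_boot all_order all_algebra.
From mathcomp Require Import boolp classical_sets ring.

Set Implicit Arguments.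
Unset Strict Implicit.
Unset Printing Implicit Defensive.

Import Order.TTheory GRing.Theory Num.Theory.
Local Open Scope ring_scope.
Local Open Scope classical_set_scope.

(* A torus element K of one Borel algebra pairs with the other one through an
   algebra character chi, and duality at K says that the convolution product
   sigma * (chi (x) chi) * sigma^-1 equals chi (x) chi, i.e. sigma commutes with
   chi (x) chi.  On monomials X_u K_v (x) X_w K_z of weight mu the two sides of
   this commutation differ by the factor q^((lambda, mu)) for chi attached to
   K_lambda, and lambda = mu gives a nontrivial factor as the form is positive
   definite; so sigma vanishes off the torus.  Duality at the generators X_i then
   prescribes sigma(K_alpha_i, -) and sigma(-, K_alpha_i), and the cocycle identity
   extends this to the root lattice.
   Conversely, for such a toral sigma the elements satisfying duality form a
   subalgebra, as both deformed structures are bialgebras, and the generators lie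
   in it because a ._sigma b is a scalar multiple of ab on monomials.  Neither
   direction needs the pairing to be nondegenerate.  The compatibility with the
   antipodes follows from uniqueness of convolution inverses once both antipodes
   are known to be bijective. *)

(** * Sweedler sums and convolution *)

(** On the torus, sigma divided by the bicharacter expected from Psi is a group 2-cocycle [t] on
    Gamma'. Duality forces [t] to be 1 as soon as one argument lies in Q, but Gamma' may be strictly
    larger than Q, and the values with both arguments outside Q stay free. This is why the
    equivalence holds with [corresponding_cocycle], and why [toral_cocycle_of] is reached only when
    Gamma' lies in Q or sigma is already toral for some Phi, in which case A^T Phi A is read off on
    the simple roots. The free values do not disturb the converse: duality at X_i involves only
    quotients of values of sigma whose arguments differ by elements of Q, and there [t] cancels. The
    antipode of H_sigma is accessible only through its axioms, so its bijectivity has to be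
    established; it is obtained from the square of the antipode, which is diagonal on the
    generators. *)

Definition trilin (K : fieldType) (V1 V2 V3 X : lmodType K)
    (f : V1 -> V2 -> V3 -> X) : Prop :=
  [/\ forall y z, linear (fun x => f x y z), forall x z, linear (fun y => f x y z)
    & forall x y, linear (f x y)].

Section SweedlerSums.
Variable K : fieldType.
Implicit Types V W X B : lmodType K.

Definition csum V X (d : V -> seq (V * V)) (f : V -> V -> X) (x : V) : X :=
  \sum_(p <- d x) f p.1 p.2.

Lemma bilinP V W X (f : V -> W -> X) :
  (forall w, linear (f^~ w)) -> (forall v, linear (f v)) -> bilin f.
Proof. by move=> h1 h2; split=> a *; [rewrite h1 | rewrite h2]. Qed.

Lemma linear_map0 V X (f : V -> X) : linear f -> f 0 = 0.
Proof. by move=> h; have := h (-1) 0 0; rewrite scaler0 addr0 scaleN1r addNr. Qed.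

Lemma linear_mapZ V X (f : V -> X) : linear f -> forall a x, f (a *: x) = a *: f x.
Proof. by move=> h a x; rewrite -[a *: x]addr0 h (linear_map0 h) addr0. Qed.

Lemma linear_mapD V X (f : V -> X) : linear f -> {morph f : x y / x + y}.
Proof. by move=> h x y; rewrite -[x in LHS]scale1r h scale1r. Qed.

Lemma linear_map_sum V X (f : V -> X) : linear f ->
  forall I (s : seq I) (F : I -> V), f (\sum_(i <- s) F i) = \sum_(i <- s) f (F i).
Proof. by move=> h I s F; apply: (big_morph f (linear_mapD h) (linear_map0 h)). Qed.

Lemma linear_sum_pointwise V X I (s : seq I) (F : I -> V -> X) :
  (forall i, linear (F i)) -> linear (fun x => \sum_(i <- s) F i x).
Proof.
move=> h a x y; rewrite scaler_sumr -big_split /=.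
by apply: eq_bigr => i _; apply: h.
Qed.

Lemma linear_comp V W X (f : W -> X) (g : V -> W) :
  linear f -> linear g -> linear (fun x => f (g x)).
Proof. by move=> hf hg a x y; rewrite hg hf. Qed.

Lemma eq_csum V X (d : V -> seq (V * V)) (f g : V -> V -> X) x :
  (forall a b, f a b = g a b) -> csum d f x = csum d g x.
Proof. by move=> h; apply: eq_bigr => p _. Qed.

Lemma csum_exchange V W X (d : V -> seq (V * V)) (d' : W -> seq (W * W))
    (f : V -> V -> W -> W -> X) v w :
  csum d (fun a b => csum d' (f a b) w) v
  = csum d' (fun r s => csum d (fun a b => f a b r s) v) w.
Proof. exact: exchange_big. Qed.

(** [d x] is an arbitrarily chosen representative of the coproduct of [x], so a sum over it is
    meaningful only for a multilinear summand; coassociativity is therefore tested on trilinear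
    maps. Keeping [d] abstract lets a coproduct and its opposite share all lemmas. *)
Record coalg V (d : V -> seq (V * V)) (e : V -> K) : Prop := Coalg {
  coalg_lin : forall X (f : V -> V -> X), bilin f -> linear (csum d f);
  coalg_assoc : forall X (f : V -> V -> V -> X), trilin f -> forall x,
    csum d (fun a c => csum d (fun a b => f a b c) a) x
    = csum d (fun a b => csum d (fun b c => f a b c) b) x;
  coalg_unitl : forall x, csum d (fun a b => e a *: b) x = x;
  coalg_unitr : forall x, csum d (fun a b => e b *: a) x = x;
  coalg_counit : scalar e }.

Definition swapd V (d : V -> seq (V * V)) (x : V) : seq (V * V) :=
  [seq (p.2, p.1) | p <- d x].

Lemma csum_swapd V X (d : V -> seq (V * V)) (f : V -> V -> X) x :
  csum (swapd d) f x = csum d (fun a b => f b a) x.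
Proof. by rewrite /csum big_map. Qed.

Lemma coalg_swapd V (d : V -> seq (V * V)) e : coalg d e -> coalg (swapd d) e.
Proof.
case=> dl da ul ur ec; split=> //.
- move=> X f bf a x y; rewrite !csum_swapd dl //.
  by apply: bilinP => w c u u' /=; [rewrite bf.2 | rewrite bf.1].
- move=> X f [f1 f2 f3] x; rewrite !csum_swapd.
  under eq_csum do rewrite csum_swapd.
  (* Reversing the three tensor factors turns coassociativity of [d], read backwards, into that of
     the opposite coproduct. *)
  rewrite -(da _ (fun a b c => f c b a)); last by split.
  by apply: eq_csum => a b; rewrite csum_swapd.
- by move=> x; rewrite csum_swapd.
- by move=> x; rewrite csum_swapd.
Qed.

End SweedlerSums.

Section Convolution.
Variables (K : fieldType) (V W B : lmodType K).
Variables (dV : V -> seq (V * V)) (eV : V -> K).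
Variables (dW : W -> seq (W * W)) (eW : W -> K).
Hypotheses (cV : coalg dV eV) (cW : coalg dW eW).
Variables (mB : B -> B -> B) (oneB : B).
Hypotheses (mB_bilin : bilin mB) (mBA : associative mB).
Hypotheses (mB1l : left_id oneB mB) (mB1r : right_id oneB mB).

(** The convolution product of Hom(V (x) W, B), for the tensor product coalgebra on V (x) W. *)
Definition conv (F G : V -> W -> B) (v : V) (w : W) : B :=
  csum dV (fun a1 a2 => csum dW (fun b1 b2 => mB (F a1 b1) (G a2 b2)) w) v.

Definition conv1 (v : V) (w : W) : B := (eV v * eW w) *: oneB.

Let mB_linl y : linear (mB^~ y).
Proof. by move=> a x x' /=; rewrite mB_bilin.1. Qed.
Let mB_linr x : linear (mB x).
Proof. by move=> a y y' /=; rewrite mB_bilin.2. Qed.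

Lemma bilin_linl (X : lmodType K) (F : V -> W -> X) w : bilin F -> linear (F^~ w).
Proof. by move=> bF a x y /=; rewrite bF.1. Qed.
Lemma bilin_linr (X : lmodType K) (F : V -> W -> X) v : bilin F -> linear (F v).
Proof. by move=> bF a x y /=; rewrite bF.2. Qed.

Lemma conv_bilin F G : bilin F -> bilin G -> bilin (conv F G).
Proof.
move=> bF bG; apply: bilinP => [w|v].
  apply: (coalg_lin cV); apply: bilinP => x; apply: linear_sum_pointwise => p.
    apply: (@linear_comp _ _ _ _ (mB^~ _) (F^~ _)) => //; exact: bilin_linl.
  apply: (@linear_comp _ _ _ _ (mB _) (G^~ _)) => //; exact: bilin_linl.
apply: linear_sum_pointwise => p.
apply: (coalg_lin cW); apply: bilinP => x.
  apply: (@linear_comp _ _ _ _ (mB^~ _) (F _)) => //; exact: bilin_linr.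
apply: (@linear_comp _ _ _ _ (mB _) (G _)) => //; exact: bilin_linr.
Qed.

Lemma convA F G H : bilin F -> bilin G -> bilin H -> forall v w,
  conv (conv F G) H v w = conv F (conv G H) v w.
Proof.
move=> bF bG bH v w.
have lF x : linear (F x) by exact: bilin_linr.
have lG x : linear (G x) by exact: bilin_linr.
have lH x : linear (H x) by exact: bilin_linr.
have lF' x : linear (F^~ x) by exact: bilin_linl.
have lG' x : linear (G^~ x) by exact: bilin_linl.
have lH' x : linear (H^~ x) by exact: bilin_linl.
(* [T] freezes the three legs of [v]: coassociativity on [w] is used inside [T], coassociativity on
   [v] outside it. *)
pose T x y z := csum dW (fun b12 b3 => csum dW (fun b1 b2 =>
  mB (mB (F x b1) (G y b2)) (H z b3)) b12) w.
have TE x y z : T x y z = csum dW (fun b1 b23 => csum dW (fun b2 b3 =>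
  mB (F x b1) (mB (G y b2) (H z b3))) b23) w.
  rewrite /T (coalg_assoc cW (f := fun b1 b2 b3 => mB (mB (F x b1) (G y b2)) (H z b3))).
    by apply: eq_csum => a b; apply: eq_csum => c e; rewrite mBA.
  split=> *; first 1 last.
  - move=> c u u' /=; rewrite (lG y) (mB_linr) (mB_linl) //.
  - move=> c u u' /=; rewrite (lH z) (mB_linr) //.
  - move=> c u u' /=; rewrite (lF x) !(mB_linl) //.
have tT : trilin T.
  split=> [y z|x z|x y]; do 2![apply: linear_sum_pointwise => ?] => c u u' /=.
  - by rewrite lF' !mB_linl.
  - by rewrite lG' mB_linr mB_linl.
  - by rewrite lH' mB_linr.
transitivity (csum dV (fun a12 a3 => csum dV (fun a1 a2 => T a1 a2 a3) a12) v).
  apply: eq_csum => a b; rewrite csum_exchange; apply: eq_csum => r s.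
  rewrite /conv (linear_map_sum (@mB_linl _)); apply: eq_bigr => p _.
  by rewrite (linear_map_sum (@mB_linl _)).
rewrite (coalg_assoc cV tT); apply: eq_csum => a b.
under eq_csum do rewrite TE.
rewrite csum_exchange; apply: eq_csum => r s.
rewrite /conv (linear_map_sum (@mB_linr _)); apply: eq_bigr => p _.
by rewrite (linear_map_sum (@mB_linr _)).
Qed.

Lemma conv1l F : bilin F -> forall v w, conv conv1 F v w = F v w.
Proof.
move=> bF v w; rewrite -{2}[v](coalg_unitl cV) -{2}[w](coalg_unitl cW).
rewrite (linear_map_sum (bilin_linl _ bF)); apply: eq_bigr => p _.
rewrite (linear_map_sum (bilin_linr _ bF)); apply: eq_bigr => r _.
rewrite (linear_mapZ (@mB_linl _)) mB1l (linear_mapZ (bilin_linl _ bF)).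
by rewrite (linear_mapZ (bilin_linr _ bF)) scalerA.
Qed.

Lemma conv1r F : bilin F -> forall v w, conv F conv1 v w = F v w.
Proof.
move=> bF v w; rewrite -{2}[v](coalg_unitr cV) -{2}[w](coalg_unitr cW).
rewrite (linear_map_sum (bilin_linl _ bF)); apply: eq_bigr => p _.
rewrite (linear_map_sum (bilin_linr _ bF)); apply: eq_bigr => r _.
rewrite (linear_mapZ (@mB_linr _)) mB1r (linear_mapZ (bilin_linl _ bF)).
by rewrite (linear_mapZ (bilin_linr _ bF)) scalerA.
Qed.

Lemma eq_conv F F' G G' v w : (forall x y, F x y = F' x y) ->
  (forall x y, G x y = G' x y) -> conv F G v w = conv F' G' v w.
Proof. by move=> h h'; apply: eq_csum => a b; apply: eq_csum => r s; rewrite h h'. Qed.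

(** The monoid argument G = G * (F * G') = (G * F) * G' = G' for a left inverse G and a right
    inverse G'. *)
Lemma conv_inv_unique F G G' : bilin F -> bilin G -> bilin G' ->
  (forall v w, conv G F v w = conv1 v w) -> (forall v w, conv F G' v w = conv1 v w) ->
  forall v w, G v w = G' v w.
Proof.
move=> bF bG bG' h h' v w; rewrite -(conv1r bG) -(conv1l bG').
rewrite -(eq_conv _ _ h (fun _ _ => erefl)) -(eq_conv _ _ (fun _ _ => erefl) h').
by rewrite convA.
Qed.

End Convolution.

(** * Antipodes and pairings *)

Section HopfSums.
Variables (K : fieldType) (V : lmodType K) (H : hopf V).
Local Notation d := (fun x => sw (hcomul H) x).

Lemma tlift_sum (X Y Z : lmodType K) (f : X -> Y -> Z) I (s : seq I) F :
  bilin f -> tlift f (\sum_(i <- s) F i) = \sum_(i <- s) tlift f (F i).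
Proof. by move=> bf; apply: linear_map_sum; apply: tlift_linear. Qed.

Lemma hopf_coalg : coalg d (hcounit H).
Proof.
have [_ _ _ _ dl el da ul ur _ _ _ _ _ _ _] := hopfP H; split=> //.
  by move=> X f bf; apply: (linear_comp (tlift_linear bf)).
move=> X f [f1 f2 f3] x.
have bf12 c : bilin (fun a b => f a b c) by apply: bilinP.
have bF : bilin (fun t c => tlift (fun a b => f a b c) t).
  apply: bilinP => [c|t]; first exact: tlift_linear.
  by apply: linear_sum_pointwise.
have := congr1 (tlift (fun t c => tlift (fun a b => f a b c) t)) (da x).
rewrite !tlift_sum // => E.
etransitivity; [etransitivity; [|exact: E]|]; apply: eq_bigr => p _;
  rewrite tlift_sum //; apply: eq_bigr => r _; by rewrite !tlift_pure.
Qed.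

Let cH := hopf_coalg.

Lemma csum_comulM (X : lmodType K) (f : V -> V -> X) x y : bilin f ->
  csum d f (hmul H x y)
  = csum d (fun a b => csum d (fun r s => f (hmul H a r) (hmul H b s)) y) x.
Proof.
move=> bf; have -> : csum d f (hmul H x y) = tlift f (hcomul H (hmul H x y)) by [].
rewrite (hopf_comulM (hopfP H)) tlift_sum //; apply: eq_bigr => p _.
by rewrite tlift_sum //; apply: eq_bigr => r _; rewrite tlift_pure.
Qed.

Lemma csum_comul1 (X : lmodType K) (f : V -> V -> X) : bilin f ->
  csum d f (hone H) = f (hone H) (hone H).
Proof.
move=> bf; have -> : csum d f (hone H) = tlift f (hcomul H (hone H)) by [].
by rewrite (hopf_comul1 (hopfP H)) tlift_pure.
Qed.

Let mul_bilin : bilin (hmul H) := hopf_mul_bilin (hopfP H).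
Let mulA : associative (hmul H) := hopf_mulA (hopfP H).
Let anti_lin : linear (hanti H) := hopf_anti_lin (hopfP H).
Let mul_linl x : linear ((hmul H)^~ x) := bilin_linl x mul_bilin.
Let mul_linr x : linear (hmul H x) := bilin_linr x mul_bilin.

Lemma anti_mull_bilin : bilin (fun a b => hmul H (hanti H a) b).
Proof. by apply: bilinP => x // a y z /=; rewrite anti_lin mul_linl. Qed.

Lemma hanti1 : hanti H (hone H) = hone H.
Proof.
have := hopf_antil (hopfP H) (hone H).
rewrite (hopf_counit1 (hopfP H)) scale1r.
have -> : \sum_(p <- sw (hcomul H) (hone H)) hmul H (hanti H p.1) p.2
          = csum d (fun a b => hmul H (hanti H a) b) (hone H) by [].
by rewrite (csum_comul1 anti_mull_bilin) (hopf_mul1r (hopfP H)).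
Qed.

(** In Hom(V (x) V, V) the left side is a left convolution inverse of the multiplication and the
    right side a right inverse. *)
Lemma hantiM x y : hanti H (hmul H x y) = hmul H (hanti H y) (hanti H x).
Proof.
move: x y.
apply: (conv_inv_unique cH cH mul_bilin mulA (hopf_mul1l (hopfP H))
  (hopf_mul1r (hopfP H)) (F := hmul H)
  (G' := fun x y => hmul H (hanti H y) (hanti H x))) => //.
- by apply: bilinP => x a y z /=; rewrite ?mul_linl ?mul_linr anti_lin.
- by apply: bilinP => x a y z /=; rewrite anti_lin ?mul_linl ?mul_linr.
- move=> x y; rewrite /conv -(csum_comulM _ _ anti_mull_bilin).
  by rewrite /conv1 -(hopf_counitM (hopfP H)) -(hopf_antil (hopfP H)).
- move=> x y; rewrite /conv1 mulrC -scalerA -(hopf_antir (hopfP H)) scaler_sumr.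
  apply: eq_bigr => p _.
  rewrite -[hcounit H y *: _](linear_mapZ (@mul_linr p.1)).
  have {2}-> : hanti H p.2 = hmul H (hone H) (hanti H p.2) by rewrite (hopf_mul1l (hopfP H)).
  rewrite -(linear_mapZ (@mul_linl (hanti H p.2))) -(hopf_antir (hopfP H)).
  rewrite (linear_map_sum (@mul_linl _)) (linear_map_sum (@mul_linr _)).
  by apply: eq_bigr => r _; rewrite !mulA.
Qed.

Variable Si : V -> V.
Hypotheses (SK : cancel (hanti H) Si) (KS : cancel Si (hanti H)).

Lemma antiinv_lin : linear Si.
Proof.
move=> a x y; apply: (can_inj SK).
by rewrite KS anti_lin !KS.
Qed.

(** Applying the anti-multiplicative antipode gives back the right antipode axiom. This is one half
    of the fact that [Si] is an antipode for the opposite coproduct. *)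
Lemma antiinv_mulr x : \sum_(p <- sw (hcomul H) x) hmul H p.2 (Si p.1)
  = hcounit H x *: hone H.
Proof.
apply: (can_inj SK); rewrite (linear_map_sum anti_lin) (linear_mapZ anti_lin) hanti1.
rewrite -(hopf_antir (hopfP H)); apply: eq_bigr => p _.
by rewrite hantiM KS.
Qed.

End HopfSums.

Lemma regular_mul_bilin (K : fieldType) :
  bilin ( *%R : K^o -> K^o -> K^o).
Proof.
by split=> a x y z; [rewrite mulrDl scalerAl | rewrite mulrDr scalerAr].
Qed.

Section PairingAntipode.
Variables (K : fieldType) (V W : lmodType K) (H : hopf V) (L : hopf W).
Variable eta : V -> W -> K^o.
Hypotheses (eta_bilin : bilin eta).
Hypotheses (eta_r : coproduct_dual_to_product H L eta).
Hypotheses (eta_l : product_dual_to_coproduct H L eta).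
Hypotheses (eta1r : forall h, eta h (hone L) = hcounit H h).
Hypotheses (eta1l : forall k, eta (hone H) k = hcounit L k).

(** In each identity the two sides are a left and a right convolution inverse of [eta]. Since [eta]
    turns products of H into the opposite coproduct of L, the first identity uses the reversed
    coproduct of L; the second keeps the coproduct of L and uses [antiinv_mulr] on H instead. *)
Lemma pairing_anti Hi Li : cancel (hanti H) Hi -> cancel Hi (hanti H) ->
    cancel (hanti L) Li -> cancel Li (hanti L) ->
  (forall h k, eta (hanti H h) k = eta h (Li k)) /\
  (forall h k, eta (Hi h) k = eta h (hanti L k)).
Proof.
move=> SK KS SK' KS'.
have [cH cL] := (hopf_coalg H, hopf_coalg L).
have lS := hopf_anti_lin (hopfP H); have lS' := hopf_anti_lin (hopfP L).
have lSi := antiinv_lin SK KS; have lSi' := antiinv_lin SK' KS'.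
have l1 w : linear (eta^~ w) by exact: bilin_linl.
have l2 v : linear (eta v) by exact: bilin_linr.
have mb := @regular_mul_bilin K.
have mA : associative ( *%R : K^o -> K^o -> K^o) by move=> *; rewrite mulrA.
have m1 : left_id 1 ( *%R : K^o -> K^o -> K^o) by move=> *; rewrite mul1r.
have m1' : right_id 1 ( *%R : K^o -> K^o -> K^o) by move=> *; rewrite mulr1.
split.
- apply: (conv_inv_unique cH (coalg_swapd cL) mb mA m1 m1' (F := eta)) => //.
  + by apply: bilinP => x a y z /=; rewrite ?lS ?l1 ?l2.
  + by apply: bilinP => x a y z /=; rewrite ?lSi' ?l1 ?l2.
  + move=> v w; rewrite /conv /conv1.
    under eq_csum do rewrite csum_swapd.
    rewrite -eta1l; transitivity (eta (hcounit H v *: hone H) w); last first.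
      by rewrite (linear_mapZ (@l1 _)); exact: esym (mulr1 _).
    rewrite -(hopf_antil (hopfP H)) (linear_map_sum (@l1 _)).
    by apply: eq_bigr => p _; rewrite eta_l.
  + move=> v w; rewrite /conv /conv1.
    under eq_csum do rewrite csum_swapd.
    rewrite csum_exchange -eta1r; transitivity (eta v (hcounit L w *: hone L)); last first.
      by rewrite (linear_mapZ (@l2 _)) mulrC; exact: esym (mulr1 _).
    rewrite -(antiinv_mulr SK' KS') (linear_map_sum (@l2 _)).
    by apply: eq_bigr => p _; rewrite eta_r.
- apply: (conv_inv_unique cH cL mb mA m1 m1' (F := eta)) => //.
  + by apply: bilinP => x a y z /=; rewrite ?lSi ?l1 ?l2.
  + by apply: bilinP => x a y z /=; rewrite ?lS' ?l1 ?l2.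
  + move=> v w; rewrite /conv /conv1.
    rewrite -eta1l; transitivity (eta (hcounit H v *: hone H) w); last first.
      by rewrite (linear_mapZ (@l1 _)); exact: esym (mulr1 _).
    rewrite -(antiinv_mulr SK KS) (linear_map_sum (@l1 _)).
    apply: eq_bigr => p _; rewrite eta_l; apply: eq_bigr => r _.
    by rewrite mulrC.
  + move=> v w; rewrite /conv /conv1.
    rewrite csum_exchange -eta1r; transitivity (eta v (hcounit L w *: hone L)); last first.
      by rewrite (linear_mapZ (@l2 _)) mulrC; exact: esym (mulr1 _).
    rewrite -(hopf_antir (hopfP L)) (linear_map_sum (@l2 _)).
    by apply: eq_bigr => p _; rewrite eta_r.
Qed.

End PairingAntipode.

(** * Monomials in quantum Borel algebras *)

Section BorelMonomials.
Variables (K : fieldType) (q : rat -> K).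
Hypotheses (q0 : q 0 = 1) (qD : forall r s, q (r + s) = q r * q s).
Variables (n : nat) (A : 'M[int]_n) (d : 'I_n -> nat).
Variables (Gam : set 'rV[rat]_n) (s : bool).
Hypotheses (G0 : 0 \in Gam) (GN : forall v, v \in Gam -> - v \in Gam).
Hypothesis GD : forall v w, v \in Gam -> w \in Gam -> v + w \in Gam.

Local Notation U := (borel q A d Gam s).
Local Notation X := (bX q A d Gam s).
Local Notation Kt := (bK q A d Gam s).
Local Notation pgn := (pgen (borel_pres q A d Gam s)).

Lemma qpow_neq0 r : q r != 0.
Proof.
apply/eqP => e; have := oner_neq0 K.
by rewrite -q0 -(subrr r) qD e mul0r eqxx.
Qed.

Lemma qpowN r : q (- r) = (q r)^-1.
Proof.
by apply: (mulfI (qpow_neq0 r)); rewrite -qD subrr q0 divff // qpow_neq0.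
Qed.

Lemma bK_gen v (hv : v \in Gam) : Kt v = pgn (GenK (exist _ v hv)).
Proof.
rewrite /bK (insubT (fun v => v \in Gam) hv) /=.
by congr (pgen _ (GenK _)); apply: val_inj.
Qed.

Lemma bK0 : Kt 0 = 1.
Proof. by rewrite (bK_gen G0) (borel_K0 (borel_holds q A d Gam s)). Qed.

Lemma bKD v w : v \in Gam -> w \in Gam -> Kt v * Kt w = Kt (v + w).
Proof.
move=> hv hw; rewrite (bK_gen hv) (bK_gen hw) (bK_gen (GD hv hw)).
exact: (borel_KM (borel_holds q A d Gam s)).
Qed.

Lemma bKX v i : v \in Gam ->
  Kt v * X i = q (bsign s * root_form A d v (sroot i)) *: (X i * Kt v).
Proof.
move=> hv; set c := q _.
have e : Kt v * X i * Kt (- v) = c *: X i.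
  rewrite (bK_gen hv) (bK_gen (GN hv)).
  exact: (borel_KX (borel_holds q A d Gam s) (g := exist _ v hv)).
by rewrite scalerAl -e -(mulrA (Kt v * X i)) bKD ?GN // addNr bK0 mulr1.
Qed.

Lemma borel_ind (P : U -> Prop) :
  (forall c x y, P x -> P y -> P (c *: x + y)) ->
  (forall x y, P x -> P y -> P (x * y)) ->
  (forall v, v \in Gam -> P (Kt v)) -> (forall i, P (X i)) -> forall x, P x.
Proof.
move=> PD PM PK PX x; rewrite -[x]preprK.
have P1 : P 1 by rewrite -bK0; apply: PK.
have P0 : P 0 by rewrite -(addNr 1) -scaleN1r; apply: PD.
elim: (prepr x) => [c|[[v hv]|i]|t IHt u IHu|t IHt u IHu] /=.
- suff -> : pclass (borel_pres q A d Gam s) (NCconst _ c) = c *: 1 + 0 by apply: PD.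
  by rewrite addr0; apply: presented_ext => C g Pg; rewrite (pliftZ Pg) (plift1 Pg) plift_class.
- by have := PK v hv; rewrite (bK_gen hv).
- exact: PX.
- rewrite (_ : pclass _ _ = 1 *: pclass (borel_pres q A d Gam s) t + pclass _ u); first exact: PD.
  by rewrite scale1r; apply: presented_ext => C g Pg; rewrite (pliftD Pg) !plift_class.
- rewrite (_ : pclass _ _ = pclass (borel_pres q A d Gam s) t * pclass _ u); first exact: PM.
  by apply: presented_ext => C g Pg; rewrite (pliftM Pg) !plift_class.
Qed.

(** [u] is an arbitrary word, so these elements span the algebra but satisfy the linear relations
    coming from Serre: linear maps are compared on them, never defined on them. *)
Definition mono (u : seq 'I_n) (v : 'rV[rat]_n) : U :=
  foldr (fun i x => X i * x) (Kt v) u.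

Definition mono_coef (w : 'rV[rat]_n) (u : seq 'I_n) : K :=
  \prod_(i <- u) q (bsign s * root_form A d w (sroot i)).

Lemma mono_coef_neq0 w u : mono_coef w u != 0.
Proof. by rewrite prodf_seq_neq0; apply/allP => i _; rewrite qpow_neq0. Qed.

Lemma bK_mono w u v : w \in Gam -> v \in Gam ->
  Kt w * mono u v = mono_coef w u *: mono u (w + v).
Proof.
move=> hw hv; rewrite /mono_coef; elim: u => [|i u IH] /=.
  by rewrite bKD // big_nil scale1r.
by rewrite big_cons mulrA bKX // -scalerAl -mulrA IH -scalerAr scalerA.
Qed.

Lemma mono_bK u v w : v \in Gam -> w \in Gam -> mono u v * Kt w = mono u (v + w).
Proof.
by move=> hv hw; elim: u => [|i u IH] /=; rewrite ?bKD // -mulrA IH.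
Qed.

Lemma mono_ind (P : U -> Prop) :
  (forall c x y, P x -> P y -> P (c *: x + y)) ->
  (forall u v, v \in Gam -> P (mono u v)) -> forall x, P x.
Proof.
move=> PD Pm x; rewrite -[x]mulr1 -bK0 -[Kt 0]/(mono [::] 0).
(* The predicate is generalised because the product case applies the induction hypothesis for the
   right factor to [fun z => P (x * z)]. *)
suff key y u v (hv : v \in Gam) (Q : U -> Prop) :
    (forall c x y, Q x -> Q y -> Q (c *: x + y)) ->
    (forall u v, v \in Gam -> Q (mono u v)) -> Q (y * mono u v) by exact: key.
move: y u v hv Q => {P PD Pm x}; apply: borel_ind.
- move=> c x y IHx IHy u v hv P PD Pm; rewrite mulrDl -scalerAl.
  by apply: (PD); [apply: IHx | apply: IHy].
- move=> x y IHx IHy u v hv P PD Pm; rewrite -mulrA.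
  apply: (IHy u v hv (fun z => P (x * z))) => [c z z' h h'|u' v' hv'].
    by rewrite mulrDr -scalerAr; apply: PD.
  exact: IHx.
- move=> w hw u v hv P PD Pm; rewrite bK_mono //.
  have P0 : P 0 by rewrite -(addNr (mono u v)) -scaleN1r; apply: PD; apply: Pm.
  by rewrite -[_ *: _]addr0; apply: PD => //; apply/Pm/GD.
- by move=> i u v hv P PD Pm; apply: (Pm (i :: u)).
Qed.

Lemma mono_ext (Y : lmodType K) (f g : U -> Y) : linear f -> linear g ->
  (forall u v, v \in Gam -> f (mono u v) = g (mono u v)) -> forall x, f x = g x.
Proof.
move=> lf lg h; apply: mono_ind => // c x y hx hy.
by rewrite lf lg hx hy.
Qed.

Lemma mono_ext2 (Y : lmodType K) (f g : U -> U -> Y) : bilin f -> bilin g ->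
  (forall u v w z, v \in Gam -> z \in Gam ->
    f (mono u v) (mono w z) = g (mono u v) (mono w z)) -> forall x y, f x y = g x y.
Proof.
move=> bf bg h x y; move: x.
apply: mono_ext => [||u v hv]; try exact: bilin_linl.
move: y; apply: mono_ext => [||w z hz]; try exact: bilin_linr.
exact: h.
Qed.

Lemma torus_projection_exists :
  exists pi : {lrmorphism U -> U}, torus_projection pi.
Proof.
have R : borel_relations q A d s
    (fun g : borel_gen Gam => if g is GenK v then pgn (GenK v) else 0).
  have [h1 h2 h3 h4] := borel_holds q A d Gam s.
  split=> //= [*|i j ij]; first by rewrite mulr0 mul0r scaler0.
  by apply: big1 => k _; rewrite mulr0 mul0r scaler0.
have [phi [h _]] := borel_universal R.
exists phi; split=> [v hv|i]; first by rewrite (bK_gen hv) h.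
exact: h.
Qed.

Lemma torus_projection_kill (pi : {lrmorphism U -> U}) : torus_projection pi ->
  forall i x, pi (X i * x) = 0.
Proof. by case=> _ h i x; rewrite rmorphM /= h mul0r. Qed.

(** Working form of factoring through the torus: [f] vanishes on the right ideals generated by the
    X_i. Monomials carry their X letters first, so only the pure torus monomials survive under
    [f]. *)
Definition killsX (Y : lmodType K) (f : U -> Y) := forall i x, f (X i * x) = 0.

Lemma killsX_proj (Y : lmodType K) (f : U -> Y) (pi : {lrmorphism U -> U}) :
  torus_projection pi -> linear f -> killsX f -> forall x, f x = f (pi x).
Proof.
move=> hpi lf kf; apply: mono_ext => //.
  by move=> c x y; rewrite linearP lf.
case=> [|i u] v hv /=; first by rewrite hpi.1.
by rewrite (torus_projection_kill hpi) kf (linear_map0 lf).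
Qed.

Lemma killsX_bK (Y : lmodType K) (f : U -> Y) v : v \in Gam -> linear f ->
  killsX f -> killsX (fun x => f (Kt v * x)).
Proof.
move=> hv lf kf i x.
by rewrite mulrA bKX // -scalerAl (linear_mapZ lf) -mulrA kf scaler0.
Qed.

Lemma scaling_exists (b : 'I_n -> K) :
  exists T : {lrmorphism U -> U},
    (forall v, v \in Gam -> T (Kt v) = Kt v) /\ (forall i, T (X i) = b i *: X i).
Proof.
have R : borel_relations q A d s (fun g : borel_gen Gam =>
    match g with GenK v => pgn (GenK v) | GenX i => b i *: X i end).
  have [h1 h2 h3 h4] := borel_holds q A d Gam s.
  split=> //= [g h j e|i j ij].
    by rewrite -scalerAr -scalerAl h3 // scalerA mulrC -scalerA.
  (* The Serre relation is homogeneous: each term contains [M] letters X_i and one letter X_j, so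
     the whole sum is rescaled by one factor. *)
  set M := `|_|%N; transitivity ((b i ^+ M * b j) *: (0 : U)); last by rewrite scaler0.
  rewrite -[in RHS](h4 i j ij) scaler_sumr; apply: eq_bigr => k _.
  rewrite !exprZn -!scalerAl -!scalerAr -!scalerAl !scalerA; congr (_ *: _).
  have -> : b i ^+ M = b i ^+ (M - k) * b i ^+ k by rewrite -exprD subnK // -ltnS.
  by rewrite -/M; ring.
have [phi [h _]] := borel_universal R.
exists phi; split=> [v hv|i]; first by rewrite (bK_gen hv) h.
exact: h.
Qed.

Section CoalgebraSums.
Variables (D : U -> seq (U * U)) (r l : 'I_n -> 'rV[rat]_n).

(** The common shape X_i -> X_i (x) K_(r i) + K_(l i) (x) X_i of the undeformed coproduct, the
    twisted one and their opposites, which differ only in the legs [r] and [l]. *)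
Record borel_coalg : Prop := BorelCoalg {
  bc_mul : forall (Y : lmodType K) (f : U -> U -> Y), bilin f -> forall x y,
    csum D f (x * y) = csum D (fun a b => csum D (fun a' b' => f (a * a') (b * b')) y) x;
  bc_K : forall (Y : lmodType K) (f : U -> U -> Y), bilin f -> forall v, v \in Gam ->
    csum D f (Kt v) = f (Kt v) (Kt v);
  bc_X : forall (Y : lmodType K) (f : U -> U -> Y), bilin f -> forall i,
    csum D f (X i) = f (X i) (Kt (r i)) + f (Kt (l i)) (X i);
  bc_r : forall i, r i \in Gam;
  bc_l : forall i, l i \in Gam }.

Definition wt (f : 'I_n -> 'rV[rat]_n) (u : seq 'I_n) := \sum_(i <- u) f i.

Lemma wt_in f u : (forall i, f i \in Gam) -> wt f u \in Gam.
Proof. by move=> h; rewrite /wt; elim/big_ind: _ => // *; apply: GD. Qed.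

Hypothesis bc : borel_coalg.

Lemma csum_bXmul (Y : lmodType K) (f : U -> U -> Y) : bilin f -> forall i x,
  csum D f (X i * x) = csum D (fun a b => f (X i * a) (Kt (r i) * b)) x
                     + csum D (fun a b => f (Kt (l i) * a) (X i * b)) x.
Proof.
move=> bf i x; rewrite (bc_mul bc bf).
pose g a b := csum D (fun a' b' => f (a * a') (b * b')) x.
have bg : bilin g.
  apply: bilinP => y; apply: linear_sum_pointwise => p c z z' /=.
    by rewrite mulrDl -scalerAl bf.1.
  by rewrite mulrDl -scalerAl bf.2.
exact: (bc_X bc bg i).
Qed.

Let bilin_mul (Y : lmodType K) (f : U -> U -> Y) x y : bilin f ->
  bilin (fun a b => f (x * a) (y * b)).
Proof.
move=> bf; apply: bilinP => w c z z' /=; rewrite mulrDr -scalerAr.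
  by rewrite bf.1.
by rewrite bf.2.
Qed.

(** Every term of the coproduct of X_u K_v with some X in its first factor is killed. The one
    remaining term has taken the left leg at each letter, which accumulates to [wt l u] in the first
    factor and leaves the full monomial in the second. *)
Lemma csum_monol (Y : lmodType K) (f : U -> U -> Y) : bilin f ->
  (forall y, killsX (f^~ y)) -> forall u v, v \in Gam ->
  csum D f (mono u v) = f (Kt (wt l u + v)) (mono u v).
Proof.
move=> bf kf u v hv; elim: u f bf kf => [|i u IH] f bf kf.
  by rewrite (bc_K bc bf) // /wt big_nil add0r.
rewrite (csum_bXmul bf) {1}/csum big1 ?add0r => [|p _]; last exact: kf.
rewrite (IH (fun a b => f (Kt (l i) * a) (X i * b))).
- by rewrite bKD ?(bc_l bc) // ?GD ?wt_in //; try exact: (bc_l bc); rewrite /wt big_cons addrA.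
- exact: bilin_mul.
- move=> y; apply: (killsX_bK (f := f^~ (X i * y)));
    [exact: (bc_l bc) | exact: bilin_linl | exact: kf].
Qed.

Lemma csum_monor (Y : lmodType K) (f : U -> U -> Y) : bilin f ->
  (forall y, killsX (f y)) -> forall u v, v \in Gam ->
  csum D f (mono u v) = f (mono u v) (Kt (wt r u + v)).
Proof.
move=> bf kf u v hv; elim: u f bf kf => [|i u IH] f bf kf.
  by rewrite (bc_K bc bf) // /wt big_nil add0r.
rewrite (csum_bXmul bf) addrC {1}/csum big1 ?add0r => [|p _]; last exact: kf.
rewrite (IH (fun a b => f (X i * a) (Kt (r i) * b))).
- by rewrite bKD ?(bc_r bc) // ?GD ?wt_in //; try exact: (bc_r bc); rewrite /wt big_cons addrA.
- exact: bilin_mul.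
- move=> y; apply: (killsX_bK (f := f (X i * y)));
    [exact: (bc_r bc) | exact: bilin_linr | exact: kf].
Qed.

End CoalgebraSums.

Lemma borel_coalg_swapd D r l : borel_coalg D r l -> borel_coalg (swapd D) l r.
Proof.
have bs (Y : lmodType K) (f : U -> U -> Y) : bilin f -> bilin (fun a b => f b a).
  by move=> bf; apply: bilinP => w c z z' /=; rewrite ?bf.1 ?bf.2.
case=> h1 h2 h3 h4 h5; split=> // Y f bf.
- move=> x y; rewrite !csum_swapd (h1 _ _ (bs _ _ bf)); apply: eq_csum => a b.
  by rewrite csum_swapd.
- by move=> v hv; rewrite csum_swapd (h2 _ _ (bs _ _ bf)).
- by move=> i; rewrite csum_swapd (h3 _ _ (bs _ _ bf)) addrC.
Qed.

Lemma borel_hopf_coalg Psi (H : hopf U) : is_borel_hopf Psi H ->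
  (forall i, right_leg A d s Psi i \in Gam) -> (forall i, left_leg A d s Psi i \in Gam) ->
  borel_coalg (fun x => sw (hcomul H) x) (right_leg A d s Psi) (left_leg A d s Psi).
Proof.
case=> hm h1 hK hX eK eX hr hl; split=> // Y f bf.
- move=> x y; rewrite -hm (csum_comulM _ _ _ bf).
  by apply: eq_csum => a b; apply: eq_csum => a' b'; rewrite !hm.
- move=> v hv; have -> : csum (fun x => sw (hcomul H) x) f (Kt v)
    = tlift f (hcomul H (Kt v)) by [].
  by rewrite hK // tlift_pure.
- move=> i; have -> : csum (fun x => sw (hcomul H) x) f (X i)
    = tlift f (hcomul H (X i)) by [].
  by rewrite hX (linear_mapD (tlift_linear bf)) !tlift_pure.
Qed.

End BorelMonomials.

(** * Bilinear forms and lattices *)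

Section CartanForms.
Variables (n : nat) (A : 'M[int]_n) (d : 'I_n -> nat).
Local Notation form := (root_form A d).
Local Notation Dm := (diag_mx (\row_i (d i)%:R : 'rV[rat]_n)).

Lemma root_formE v w : form v w = (v *m (Dm *m AQ A) *m w^T) 0 0.
Proof.
rewrite -mulmxA mxE; apply: eq_bigr => i _.
rewrite mxE mulr_sumr; apply: eq_bigr => j _.
by rewrite mul_diag_mx !mxE; ring.
Qed.

Lemma root_formDl u v w : form (u + v) w = form u w + form v w.
Proof. by rewrite !root_formE !mulmxDl mxE. Qed.
Lemma root_formDr u v w : form w (u + v) = form w u + form w v.
Proof. by rewrite !root_formE linearD /= mulmxDr mxE. Qed.
Lemma root_form0l w : form 0 w = 0.
Proof. by rewrite root_formE !mul0mx mxE. Qed.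
Lemma twist_formDl Psi u v w :
  twist_form A Psi (u + v) w = twist_form A Psi u w + twist_form A Psi v w.
Proof. by rewrite /twist_form !mulmxDl mxE. Qed.
Lemma twist_formDr Psi u v w :
  twist_form A Psi w (u + v) = twist_form A Psi w u + twist_form A Psi w v.
Proof. by rewrite /twist_form linearD /= mulmxDr mxE. Qed.
Lemma twist_form0l Psi w : twist_form A Psi 0 w = 0.
Proof. by rewrite /twist_form !mul0mx mxE. Qed.
Lemma twist_form0r Psi w : twist_form A Psi w 0 = 0.
Proof. by rewrite /twist_form trmx0 mulmx0 mxE. Qed.

Lemma twist_form_sroot Psi i j : twist_form A Psi (sroot i) (sroot j)
  = ((AQ A)^T *m Psi *m AQ A) i j.
Proof. by rewrite /twist_form; set M := _ *m AQ A; rewrite -rowE trmx_delta -colE !mxE. Qed.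

Lemma twist_form_antisym Psi v w : antisym Psi ->
  twist_form A Psi w v = - twist_form A Psi v w.
Proof.
move=> hP; rewrite /twist_form; set M := _ *m AQ A.
have MT : M^T = - M by rewrite /M !trmx_mul trmxK hP mulNmx mulmxN mulmxA.
have -> : (w *m M *m v^T) 0 0 = (w *m M *m v^T)^T 0 0 by rewrite [RHS]mxE.
by rewrite trmx_mul trmxK (trmx_mul w) MT mulmxA mulmxN mulNmx mxE.
Qed.

Hypothesis hA : finite_cartan_datum A d.

Lemma root_formC v w : form v w = form w v.
Proof.
have MT : (Dm *m AQ A)^T = Dm *m AQ A.
  apply/matrixP => i j; rewrite !mul_diag_mx !mxE.
  by have := congr1 (fun x : int => x%:~R : rat) (cartan_sym hA j i); rewrite !rmorphM /= -!pmulrn.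
have -> : form v w = (v *m (Dm *m AQ A) *m w^T)^T 0 0 by rewrite [RHS]mxE root_formE.
by rewrite root_formE trmx_mul trmxK (trmx_mul v) MT mulmxA.
Qed.

Lemma psi_minusE Psi v : psi_minus A d Psi v
  = v *m ((AQ A)^T *m Psi *m diag_mx (\row_i ((d i)%:R)^-1)).
Proof.
rewrite /psi_minus mulmx_sum_row; apply: eq_bigr => l _.
apply/rowP => k; rewrite mul_mx_diag !mxE.
rewrite summxE (bigD1 k) //= [X in _ + X]big1 ?addr0; last first.
  move=> i ik; rewrite summxE; apply: big1 => j _.
  by rewrite !mxE eq_sym (negbTE ik) andbF mulr0.
rewrite summxE mulr_suml mulr_sumr; apply: eq_bigr => j _.
by rewrite !mxE !eqxx /=; ring.
Qed.

Lemma psi_plus_minus Psi v : antisym Psi -> psi_plus A d Psi v = - psi_minus A d Psi v.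
Proof.
move=> hP; rewrite /psi_plus /psi_minus.
do 3![rewrite -sumrN; apply: eq_bigr => ? _].
set i := (X in sroot X); set l := (X in v 0 X).
have E j k : Psi j k = - Psi k j.
  by have := congr1 (fun M : 'M__ => M k j) hP; rewrite !mxE.
by rewrite E -scaleNr; congr (_ *: _); ring.
Qed.

(** The factors 1/d_i in [psi_minus] cancel the d_i of the form. Through this identity the legs of
    the twisted coproduct produce the exponents of the toral cocycle. *)
Lemma root_form_psi Psi v w : form (psi_minus A d Psi v) w = twist_form A Psi v w.
Proof.
rewrite root_formE psi_minusE /twist_form; congr ((_ *m _) 0 0).
rewrite -!mulmxA; do 3![congr (_ *m _)]; rewrite mulmxA -[RHS]mul1mx.
congr (_ *m _); apply/matrixP => i j; rewrite mul_diag_mx !mxE.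
case: eqP => [->|_]; last by rewrite mulr0n mulr0.
by rewrite !mulr1n mulVf // pnatr_eq0 -lt0n (cartan_d_gt0 hA).
Qed.

Lemma wt_sroot_pos u : u != [::] -> 0 < form (wt (@sroot n) u) (wt (@sroot n) u).
Proof.
move=> hu; apply: (cartan_posdef hA); apply/eqP => e.
(* The coordinates of the weight of a word add up to its length, so a nonempty word has nonzero
   weight. *)
have : \sum_i wt (@sroot n) u 0 i = (size u)%:R :> rat.
  elim: u {hu e} => [|i u IH]; first by rewrite /wt big_nil big1 // => i _; rewrite mxE.
  rewrite /wt big_cons -/(wt _ u).
  rewrite (eq_bigr (fun j => sroot i 0 j + wt (@sroot n) u 0 j)) => [|j _]; last by rewrite mxE.
  rewrite big_split /= IH (bigD1 i) //= big1 ?addr0; last first.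
    by move=> j ji; rewrite mxE (negbTE ji) andbF.
  by rewrite mxE !eqxx -natrD.
rewrite e big1 => [|i _]; last by rewrite mxE.
by move/esym/eqP; rewrite pnatr_eq0 size_eq0 (negbTE hu).
Qed.

End CartanForms.

Section RootLattice.
Variable n : nat.
Local Notation Q := (@root_lattice n).

Lemma root_lattice_ind (P : 'rV[rat]_n -> Prop) : P 0 ->
  (forall v w, P v -> P w -> P (v + w)) -> (forall v, P v -> P (- v)) ->
  (forall i, P (sroot i)) -> forall v, v \in Q -> P v.
Proof.
move=> P0 PD PN PS v; rewrite in_setE => -[c ->].
rewrite [map_mx _ _]row_sum_delta; elim/big_ind: _ => // i _; rewrite mxE.
have Pn m : P (m%:R *: sroot i).
  elim: m => [|m IH]; first by rewrite scale0r.
  by rewrite -natr1 scalerDl scale1r; apply: PD.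
case: (c 0 i) => m; first exact: Pn.
by rewrite NegzE rmorphN scaleNr; apply/PN/Pn.
Qed.

Lemma root_lattice0 : 0 \in Q.
Proof. by rewrite in_setE; exists 0; rewrite map_mx0. Qed.

Lemma root_latticeD v w : v \in Q -> w \in Q -> v + w \in Q.
Proof.
rewrite !in_setE => -[c ->] [e ->]; exists (c + e).
by apply/rowP => i; rewrite !mxE rmorphD.
Qed.

Lemma root_latticeN v : v \in Q -> - v \in Q.
Proof.
rewrite !in_setE => -[c ->]; exists (- c).
by apply/rowP => i; rewrite !mxE rmorphN.
Qed.

Lemma root_lattice_sroot i : sroot i \in Q.
Proof.
rewrite in_setE; exists (delta_mx 0 i); apply/rowP => j; rewrite !mxE.
by case: (_ && _).
Qed.

End RootLattice.

Section TwistedLattice.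
Variables (n : nat) (A : 'M[int]_n) (d : 'I_n -> nat) (Psi : 'M[rat]_n).
Local Notation Q := (@root_lattice n).
Local Notation psim := (psi_minus A d Psi).
Local Notation psip := (psi_plus A d Psi).

Lemma lattice_closed (G : set 'rV[rat]_n) : is_lattice G ->
  [/\ G 0, forall v, G v -> G (- v) & forall v w, G v -> G w -> G (v + w)].
Proof.
case=> B [_ ->]; split.
- by exists 0; rewrite map_mx0 mul0mx.
- move=> _ [c ->]; exists (- c); rewrite -mulNmx; congr (_ *m _).
  by apply/rowP => i; rewrite !mxE rmorphN.
- move=> _ _ [c ->] [e ->]; exists (c + e); rewrite -mulmxDl; congr (_ *m _).
  by apply/rowP => i; rewrite !mxE rmorphD.
Qed.

Lemma psi_minusD v w : psim (v + w) = psim v + psim w.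
Proof. by rewrite !psi_minusE mulmxDl. Qed.
Lemma psi_minusN v : psim (- v) = - psim v.
Proof. by rewrite !psi_minusE mulNmx. Qed.
Lemma psi_minus0 : psim 0 = 0.
Proof. by rewrite psi_minusE mul0mx. Qed.

Hypothesis hP : antisym Psi.
Variables G1 G2 : set 'rV[rat]_n.
Hypotheses (L1 : is_lattice G1) (L2 : is_lattice G2).
Hypotheses (Q1 : Q `<=` G1) (Q2 : Q `<=` G2).
Local Notation G := (twisted_lattice A d Psi G1 G2).

Lemma twisted_latticeP v : reflect
  (exists u w c, [/\ G1 u, G2 w, Q c & v = u - psim u - psim w + c]) (v \in G).
Proof.
apply: (iffP idP); rewrite in_setE => -[u [w [c [h1 h2 h3 ->]]]]; exists u, w, c; split=> //.
  by rewrite psi_plus_minus.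
by rewrite psi_plus_minus.
Qed.

Lemma twisted_latticeD v w : v \in G -> w \in G -> v + w \in G.
Proof.
have [[_ _ D1] [_ _ D2]] := (lattice_closed L1, lattice_closed L2).
move=> /twisted_latticeP [u [x [c [h1 h2 h3 ->]]]].
move=> /twisted_latticeP [u' [x' [c' [h1' h2' h3' ->]]]].
apply/twisted_latticeP; exists (u + u'), (x + x'), (c + c'); split; auto.
  by rewrite -in_setE root_latticeD // in_setE.
rewrite !psi_minusD; move: (psim _) (psim _) (psim _) (psim _) => *.
by apply/rowP => i; rewrite !mxE; ring.
Qed.

Lemma twisted_latticeN v : v \in G -> - v \in G.
Proof.
have [[_ N1 _] [_ N2 _]] := (lattice_closed L1, lattice_closed L2).
move=> /twisted_latticeP [u [x [c [h1 h2 h3 ->]]]].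
apply/twisted_latticeP; exists (- u), (- x), (- c); split; auto.
  by rewrite -in_setE root_latticeN // in_setE.
by rewrite !psi_minusN !opprD.
Qed.

Lemma root_twisted_lattice v : v \in Q -> v \in G.
Proof.
have [[Z1 _ _] [Z2 _ _]] := (lattice_closed L1, lattice_closed L2).
rewrite in_setE => hv; apply/twisted_latticeP; exists 0, 0, v; split=> //.
by rewrite psi_minus0 !subr0 add0r.
Qed.

Lemma psi_twisted_lattice i : psim (sroot i) \in G.
Proof.
have [[Z1 _ _] [_ N2 _]] := (lattice_closed L1, lattice_closed L2).
(* psi_-(alpha_i) = - psi_-(-alpha_i), with -alpha_i taken in [G2], which contains the root
   lattice. *)
apply/twisted_latticeP; exists 0, (- sroot i), 0; split=> //.
- by apply/N2/Q2; rewrite -in_setE root_lattice_sroot.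
- by rewrite -in_setE root_lattice0.
- by rewrite psi_minusN psi_minus0 !sub0r oppr0 add0r addr0 opprK.
Qed.

End TwistedLattice.

(** * Duality and toral cocycles *)

Section TorusCocycle.
Variables (K : fieldType) (n : nat) (G : set 'rV[rat]_n).
Hypotheses (G0 : 0 \in G) (GN : forall v, v \in G -> - v \in G).
Hypothesis GD : forall v w, v \in G -> w \in G -> v + w \in G.
Variable t : 'rV[rat]_n -> 'rV[rat]_n -> K.
Hypotheses (t0l : forall v, v \in G -> t 0 v = 1) (t0r : forall v, v \in G -> t v 0 = 1).
Hypothesis t_cocycle : forall a b c, a \in G -> b \in G -> c \in G ->
  t b c * t a (b + c) = t a b * t (a + b) c.

(** The radical of [t]. By the cocycle identity [t] does not change when such an element is added to
    either argument, so these elements form a subgroup. *)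
Definition cocycle_trivial x :=
  [/\ x \in G, forall c, c \in G -> t x c = 1 & forall c, c \in G -> t c x = 1].

Lemma cocycle_shiftl x v c : cocycle_trivial x -> v \in G -> c \in G -> t (x + v) c = t v c.
Proof.
case=> hx h1 h2 hv hc; have := t_cocycle hx hv hc.
by rewrite !h1 ?GD // mulr1 mul1r.
Qed.

Lemma cocycle_shiftr x v c : cocycle_trivial x -> v \in G -> c \in G -> t c (x + v) = t c v.
Proof.
case=> hx h1 h2 hv hc; have := t_cocycle hc hv hx.
by rewrite !h2 ?GD // mulr1 mul1r addrC.
Qed.

Lemma cocycle_trivialD x y : cocycle_trivial x -> cocycle_trivial y ->
  cocycle_trivial (x + y).
Proof.
move=> hx hy; case: (hy) => Gy y1 y2; case: (hx) => Gx _ _; split; first exact: GD.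
  by move=> c hc; rewrite cocycle_shiftl // y1.
by move=> c hc; rewrite cocycle_shiftr // y2.
Qed.

Lemma cocycle_trivialN x : cocycle_trivial x -> cocycle_trivial (- x).
Proof.
move=> hx; case: (hx) => Gx _ _; split; first exact: GN.
  by move=> c hc; rewrite -(cocycle_shiftl hx) ?GN // subrr t0l.
by move=> c hc; rewrite -(cocycle_shiftr hx) ?GN // subrr t0r.
Qed.

End TorusCocycle.

(* The cocycle lives on W; s is the sign of V.  For a cocycle on the negative
   Borel algebra theta is eta, and for one on the positive Borel algebra it is eta
   with its arguments exchanged and the coproducts dV, dP of V reversed: since
   psi_+ = - psi_-, both cases then have the same legs.  dP is the deformed
   coproduct of V, f and g are sigma and its inverse, and dW' is the coproduct of
   W in the orientation in which theta is multiplicative in V. *)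
Section Duality.
Variables (K : fieldType) (q : rat -> K).
Hypotheses (q0 : q 0 = 1) (qD : forall r s, q (r + s) = q r * q s).
Hypothesis q_inj : forall r, q r = 1 -> r = 0.
Variables (n : nat) (A : 'M[int]_n) (d : 'I_n -> nat).
Hypothesis hA : finite_cartan_datum A d.
Variable Psi : 'M[rat]_n.
Hypothesis hP : antisym Psi.
Variables (Gv Gw : set 'rV[rat]_n) (s : bool).
Hypothesis Gv0 : 0 \in Gv.
Hypothesis GvD : forall v w, v \in Gv -> w \in Gv -> v + w \in Gv.
Hypotheses (Gw0 : 0 \in Gw) (GwN : forall v, v \in Gw -> - v \in Gw).
Hypothesis GwD : forall v w, v \in Gw -> w \in Gw -> v + w \in Gw.
Hypotheses (QGv : forall v, v \in @root_lattice n -> v \in Gv).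
Hypotheses (QGw : forall v, v \in @root_lattice n -> v \in Gw).

Local Notation form := (root_form A d).
Local Notation tw := (twist_form A Psi).
Local Notation ps i := (psi_minus A d Psi (sroot i)).
Local Notation V := (borel q A d Gv s).
Local Notation W := (borel q A d Gw (~~ s)).
Local Notation Kv := (bK q A d Gv s).
Local Notation Kw := (bK q A d Gw (~~ s)).
Local Notation Xv := (bX q A d Gv s).
Local Notation Xw := (bX q A d Gw (~~ s)).
Local Notation mono := (@mono K q n A d Gw (~~ s)).

Variables (dV dP : V -> seq (V * V)) (r0 l0 rP lP : 'I_n -> 'rV[rat]_n).
Hypotheses (bV : borel_coalg dV r0 l0) (bP : borel_coalg dP rP lP).
Hypothesis dP_lin : forall (Y : lmodType K) (f : V -> V -> Y), bilin f -> linear (csum dP f).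
Hypotheses (r0E : forall i, r0 i = 0) (rPE : forall i, rP i = ps i).
Hypothesis lPE : forall i, l0 i = lP i + ps i.

Variables (dW dW' : W -> seq (W * W)) (eW : W -> K) (rW lW : 'I_n -> 'rV[rat]_n).
Hypotheses (cW : coalg dW eW) (bW : borel_coalg dW rW lW).
Hypotheses (eWK : forall v, v \in Gw -> eW (Kw v) = 1).
Hypotheses (eWX : killsX (eW : W -> K^o)).
Hypothesis lrW : forall i, lW i = sroot i + rW i.
Hypothesis lrW0 : forall i, (lW i == 0) || (rW i == 0).

Variable theta : V -> W -> K^o.
Hypothesis theta_bilin : bilin theta.
Hypothesis theta_mulr : forall v w w',
  theta v (w * w') = csum dV (fun a b => theta a w * theta b w' : K^o) v.
Hypothesis theta_mull : forall v v' w,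
  theta (v * v') w = csum dW' (fun a b => theta v a * theta v' b : K^o) w.
Hypothesis thetaKK : forall v w, v \in Gv -> w \in Gw -> theta (Kv v) (Kw w) = q (- form v w).
Hypothesis thetaXK : forall i w, w \in Gw -> theta (Xv i) (Kw w) = 0.
Hypothesis thetaKX : forall v i, v \in Gv -> theta (Kv v) (Xw i) = 0.
Hypothesis thetaXX : forall i j, i != j -> theta (Xv i) (Xw j) = 0.
Hypothesis thetaXX0 : forall i, theta (Xv i) (Xw i) != 0.

Variables (f g : W -> W -> K^o).
Hypotheses (f_bilin : bilin f) (g_bilin : bilin g).
Hypothesis fg1 : forall a b, csum dW (fun a1 a2 => csum dW (fun b1 b2 =>
  f a1 b1 * g a2 b2 : K^o) b) a = eW a * eW b.
Hypothesis gf1 : forall a b, csum dW (fun a1 a2 => csum dW (fun b1 b2 =>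
  g a1 b1 * f a2 b2 : K^o) b) a = eW a * eW b.
Hypothesis f_cocycle : forall a b c,
  csum dW (fun b1 b2 => csum dW (fun c1 c2 => f b1 c1 * f a (b2 * c2) : K^o) c) b
  = csum dW (fun a1 a2 => csum dW (fun b1 b2 => f a1 b1 * f (a2 * b2) c : K^o) b) a.
Hypotheses (f1l : forall a, f 1 a = eW a) (f1r : forall a, f a 1 = eW a).

Variable m : W -> W -> W.
Hypothesis m_bilin : bilin m.
Hypothesis mE : forall a b, m a b =
  csum dW (fun a1 a' => csum dW (fun a2 a3 => csum dW (fun b1 b' => csum dW (fun b2 b3 =>
    (f a1 b1 * g a3 b3) *: (a2 * b2)) b') b) a') a.
Hypothesis m_comul : forall (F : W -> W -> K^o), bilin F -> forall a b,
  csum dW' F (m a b) = csum dW' (fun a1 a2 => csum dW' (fun b1 b2 =>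
    F (m a1 b1) (m a2 b2)) b) a.

Let Kw0 : Kw 0 = 1 := bK0 q A d (~~ s) Gw0.
Let lth1 w : linear (theta^~ w) := bilin_linl w theta_bilin.
Let lth2 v : linear (theta v) := bilin_linr v theta_bilin.
Let lf1 w : linear (f^~ w) := bilin_linl w f_bilin.
Let lf2 v : linear (f v) := bilin_linr v f_bilin.
Let lg1 w : linear (g^~ w) := bilin_linl w g_bilin.
Let lg2 v : linear (g v) := bilin_linr v g_bilin.

Lemma bilin_mulr (V1 V2 : lmodType K) (F : V1 -> K^o) (G : V2 -> K^o) :
  linear F -> linear G -> bilin (fun a b => F a * G b : K^o).
Proof.
move=> lF lG; apply: bilinP => w c x y /=; rewrite ?lF ?lG.
  by rewrite mulrDl scalerAl.
by rewrite mulrDr scalerAr.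
Qed.

Lemma bilin_mul2 (V1 V2 : lmodType K) (F G : V1 -> V2 -> K^o) x y :
  bilin F -> bilin G -> bilin (fun a b => F a x * G b y : K^o).
Proof. by move=> bF bG; apply: bilin_mulr; apply: bilin_linl. Qed.

Lemma thetaK_mul v w w' : v \in Gv ->
  theta (Kv v) (w * w') = theta (Kv v) w * theta (Kv v) w'.
Proof. by move=> hv; rewrite theta_mulr (bc_K bV) //; apply: bilin_mul2. Qed.

Lemma thetaX_mul i w w' : theta (Xv i) (w * w')
  = theta (Xv i) w * theta (Kv 0) w' + theta (Kv (l0 i)) w * theta (Xv i) w'.
Proof. by rewrite theta_mulr (bc_X bV) ?r0E //; apply: bilin_mul2. Qed.

Lemma thetaK_mono v u w : v \in Gv -> w \in Gw ->
  theta (Kv v) (mono u w) = if u is [::] then q (- form v w) else 0.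
Proof.
by move=> hv hw; case: u => [|i u] /=; [exact: thetaKK | rewrite thetaK_mul // thetaKX // mul0r].
Qed.

(** As the right leg [r0] is zero, once the first letter is paired with X_i the rest of the monomial
    meets K_0: another letter gives 0, and a torus factor gives 1. *)
Lemma thetaX_mono i u w : w \in Gw ->
  theta (Xv i) (mono u w) = if u is [:: j] then theta (Xv i) (Xw j) else 0.
Proof.
move=> hw; case: u => [|j u] /=; first exact: thetaXK.
rewrite thetaX_mul thetaKX ?(bc_l bV) // mul0r addr0 thetaK_mono //.
by case: u => [|k u]; rewrite ?mulr0 // root_form0l oppr0 q0 mulr1.
Qed.

Section Kills.
Variable Y : lmodType K.
Variables (F : W -> W -> K^o) (G : W -> W -> Y).
Hypotheses (bF : bilin F) (bG : bilin G).
Hypotheses (kF1 : forall y, killsX (F^~ y)) (kF2 : forall x, killsX (F x)).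

Lemma csum2_monol u v w z : v \in Gw -> z \in Gw ->
  csum dW (fun a1 a2 => csum dW (fun b1 b2 => F a1 b1 *: G a2 b2) (mono w z)) (mono u v)
  = F (Kw (wt lW u + v)) (Kw (wt lW w + z)) *: G (mono u v) (mono w z).
Proof.
move=> hv hz; rewrite (csum_monol Gw0 GwN GwD bW) //.
- rewrite (csum_monol Gw0 GwN GwD bW) //.
    apply: bilinP => x c y y' /=; rewrite ?bF.2 ?bG.2 ?scalerDl ?scalerDr !scalerA //.
    by rewrite mulrC.
  by move=> y i x /=; rewrite kF2 scale0r.
- apply: bilinP => x; apply: linear_sum_pointwise => p c y y' /=;
    rewrite ?bF.1 ?bG.1 ?scalerDl ?scalerDr !scalerA //.
  by rewrite mulrC.
- by move=> y i x /=; apply: big1 => p _; rewrite kF1 scale0r.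
Qed.

Lemma csum2_monor u v w z : v \in Gw -> z \in Gw ->
  csum dW (fun a1 a2 => csum dW (fun b1 b2 => F a2 b2 *: G a1 b1) (mono w z)) (mono u v)
  = F (Kw (wt rW u + v)) (Kw (wt rW w + z)) *: G (mono u v) (mono w z).
Proof.
move=> hv hz; rewrite (csum_monor Gw0 GwN GwD bW) //.
- rewrite (csum_monor Gw0 GwN GwD bW) //.
    apply: bilinP => x c y y' /=; rewrite ?bF.2 ?bG.2 ?scalerDl ?scalerDr !scalerA //.
    by rewrite mulrC.
  by move=> y i x /=; rewrite kF2 scale0r.
- apply: bilinP => x; apply: linear_sum_pointwise => p c y y' /=;
    rewrite ?bF.1 ?bG.1 ?scalerDl ?scalerDr !scalerA //.
  by rewrite mulrC.
- by move=> y i x /=; apply: big1 => p _; rewrite kF1 scale0r.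
Qed.

End Kills.

(* For a toral cocycle the deformed product of the monomials X_u K_v and X_w K_z
   is this scalar times their product. *)
Definition toral_coef u v w z :=
  f (Kw (wt lW u + v)) (Kw (wt lW w + z)) * g (Kw (wt rW u + v)) (Kw (wt rW w + z)).

Lemma fgK v w : v \in Gw -> w \in Gw -> f (Kw v) (Kw w) * g (Kw v) (Kw w) = 1.
Proof.
move=> hv hw; have := fg1 (Kw v) (Kw w); rewrite !eWK // mulr1 => <-.
under eq_csum => a b do rewrite (bc_K bW (bilin_mulr (lf2 a) (lg2 b)) hw).
by rewrite (bc_K bW (bilin_mul2 _ _ f_bilin g_bilin) hv).
Qed.

(** Groups the deformed product as sigma * (mul * sigma^-1), the shape to which [csum2_monol] and
    then [csum2_monor] apply. *)
Lemma m_conv a b : m a b = csum dW (fun a1 a' => csum dW (fun b1 b' => f a1 b1 *: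
  csum dW (fun a2 a3 => csum dW (fun b2 b3 => g a3 b3 *: (a2 * b2)) b') a') b) a.
Proof.
rewrite mE; apply: eq_csum => a1 a'; rewrite csum_exchange; apply: eq_csum => b1 b'.
rewrite scaler_sumr; apply: eq_bigr => p _; rewrite scaler_sumr; apply: eq_bigr => r _.
by rewrite scalerA.
Qed.

Lemma mul_bilin_alg : bilin (fun a b : W => a * b).
Proof. by split=> c x y z; [rewrite mulrDl scalerAl | rewrite mulrDr scalerAr]. Qed.

Lemma bilin_csum2 (Y : lmodType K) (F : W -> W -> K^o) (G : W -> W -> Y) :
  bilin F -> bilin G ->
  bilin (fun a b => csum dW (fun a1 a2 => csum dW (fun b1 b2 => F a2 b2 *: G a1 b1) b) a).
Proof.
move=> bF bG; apply: bilinP => [b|a].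
  apply: (coalg_lin cW); apply: bilinP => x; apply: linear_sum_pointwise => p c y y' /=;
    rewrite ?bF.1 ?bG.1 ?scalerDl ?scalerDr !scalerA //.
  by rewrite mulrC.
apply: linear_sum_pointwise => p; apply: (coalg_lin cW); apply: bilinP => x c y y' /=;
  rewrite ?bF.2 ?bG.2 ?scalerDl ?scalerDr !scalerA //.
by rewrite mulrC.
Qed.

(** * The deformed product of a cocycle that vanishes off the torus *)

Section Toral.
Hypotheses (kf1 : forall y, killsX (f^~ y)) (kf2 : forall x, killsX (f x)).

(** The inverse inherits the vanishing of [f]: in f * g = eps (x) eps only the term f(K, K) g(X_u
    K_v, X_w K_z) survives on the left, the right side is 0, and f(K, K) is invertible. *)
Lemma g_mono u v w z : v \in Gw -> z \in Gw -> u ++ w != [::] ->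
  g (mono u v) (mono w z) = 0.
Proof.
move=> hv hz uw; have := fg1 (mono u v) (mono w z).
rewrite (csum2_monol f_bilin g_bilin) //.
have -> : eW (mono u v) * eW (mono w z) = 0.
  by case: u w uw => [|i u] [|j w] //= _; rewrite eWX ?mul0r ?mulr0.
move/eqP; rewrite scaler_eq0 => /orP[/eqP e|/eqP] //.
have hL x y : y \in Gw -> wt lW x + y \in Gw.
  by move=> hy; apply: GwD => //; apply: wt_in => //; apply: (bc_l bW).
by have := fgK (hL u v hv) (hL w z hz); rewrite e mul0r => /esym/eqP; rewrite oner_eq0.
Qed.

Lemma g_kills1 y : killsX (g^~ y).
Proof.
move=> i x; apply: (mono_ext2 Gw0 GwN GwD (f := fun x y => g (Xw i * x) y)
  (g := fun _ _ => 0)) => [||u v w z hv hz].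
- by apply: bilinP => z c a b /=; rewrite ?mulrDr -?scalerAr ?lg1 ?lg2.
- by apply: bilinP => z c a b /=; rewrite scaler0 addr0.
- exact: (@g_mono (i :: u)).
Qed.

Lemma g_kills2 x : killsX (g x).
Proof.
move=> i y; apply: (mono_ext2 Gw0 GwN GwD (f := fun x y => g x (Xw i * y))
  (g := fun _ _ => 0)) => [||u v w z hv hz].
- by apply: bilinP => z c a b /=; rewrite ?mulrDr -?scalerAr ?lg1 ?lg2.
- by apply: bilinP => z c a b /=; rewrite scaler0 addr0.
- by apply: (@g_mono u v (i :: w)) => //; case: (u).
Qed.

(** sigma reads the first tensor factors and sigma^-1 the last ones. Both survive only on torus
    elements, so all X letters stay in the middle factors, which are multiplied undeformed. *)
Lemma m_mono u v w z : v \in Gw -> z \in Gw ->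
  m (mono u v) (mono w z) = toral_coef u v w z *: (mono u v * mono w z).
Proof.
move=> hv hz; rewrite m_conv.
rewrite (csum2_monol f_bilin (bilin_csum2 g_bilin mul_bilin_alg)) //.
rewrite (csum2_monor g_bilin mul_bilin_alg) ?scalerA //.
  exact: g_kills1.
exact: g_kills2.
Qed.

End Toral.

Definition dual_pairing : Prop := forall v a b,
  theta v (m a b) = csum dP (fun x y => theta x a * theta y b : K^o) v.

Let qneq0 := qpow_neq0 q0 qD.
Let qN := qpowN q0 qD.

Let lW_in i : lW i \in @root_lattice n.
Proof.
have /orP[/eqP->|/eqP e] := lrW0 i; first exact: root_lattice0.
by rewrite lrW e addr0 root_lattice_sroot.
Qed.

Let rW_in i : rW i \in @root_lattice n.
Proof.
have -> : rW i = lW i - sroot i by rewrite lrW addrC addKr.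
by rewrite root_latticeD ?lW_in // root_latticeN // root_lattice_sroot.
Qed.

Let L_in u v : v \in Gw -> wt lW u + v \in Gw.
Proof. by move=> hv; apply: GwD => //; apply: wt_in => // i; apply/QGw/lW_in. Qed.

Let R_in u v : v \in Gw -> wt rW u + v \in Gw.
Proof. by move=> hv; apply: GwD => //; apply: wt_in => // i; apply/QGw/rW_in. Qed.

Let wt_lr u : wt lW u = wt (@sroot n) u + wt rW u.
Proof.
by rewrite /wt -big_split; apply: eq_bigr => i _; rewrite lrW.
Qed.

(** * From duality to vanishing off the torus *)

Section Forward.
Hypothesis dual : dual_pairing.

Let convW (F G : W -> W -> K^o) := conv dW dW ( *%R : K^o -> K^o -> K^o) F G.
Let mulRA : associative ( *%R : K^o -> K^o -> K^o). Proof. by move=> *; rewrite mulrA. Qed.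
Let mulR1 : right_id 1 ( *%R : K^o -> K^o -> K^o). Proof. by move=> *; rewrite mulr1. Qed.
Let mulRb := @regular_mul_bilin K.

Lemma dual_character_commutes v a b : v \in Gv ->
  csum dW (fun a1 a2 => csum dW (fun b1 b2 =>
    (theta (Kv v) a2 * theta (Kv v) b2) *: f a1 b1) b) a
  = csum dW (fun a1 a2 => csum dW (fun b1 b2 =>
    (theta (Kv v) a1 * theta (Kv v) b1) *: f a2 b2) b) a.
Proof.
move=> hv; pose C a b : K^o := theta (Kv v) a * theta (Kv v) b.
have bC : bilin C by apply: bilin_mulr.
have mC x y : convW f (convW C g) x y = C x y.
  have := dual (Kv v) x y; rewrite (bc_K bP (bilin_mul2 x y theta_bilin theta_bilin) hv).
  rewrite m_conv /C => <-; rewrite (linear_map_sum (lth2 _)); apply: eq_bigr => p _.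
  rewrite (linear_map_sum (lth2 _)); apply: eq_bigr => r _.
  rewrite (linear_mapZ (lth2 _)); congr (_ * _).
  rewrite (linear_map_sum (lth2 _)); apply: eq_bigr => p' _.
  rewrite (linear_map_sum (lth2 _)); apply: eq_bigr => r' _.
  by rewrite (linear_mapZ (lth2 _)) thetaK_mul // mulrC.
have cb := conv_bilin cW cW mulRb.
have gf x y : convW g f x y = conv1 eW eW 1 x y.
  by rewrite /convW /conv gf1; symmetry; apply: mulr1.
transitivity (convW f C a b).
  by apply: eq_csum => a1 a2; apply: eq_csum => b1 b2; rewrite [RHS]mulrC.
transitivity (convW C f a b); last by [].
(* Substitute f * C * g for [C], then cancel g * f on the right. *)
transitivity (convW (convW f (convW C g)) f a b); last exact: eq_conv.
rewrite /convW (convA cW cW) //; try exact: cb; apply: eq_conv => // x y.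
rewrite -(conv1r cW cW mulRb mulR1 bC) (convA cW cW) //.
exact: eq_conv.
Qed.

Lemma dual_f_mono u v w z : v \in Gw -> z \in Gw -> u ++ w != [::] ->
  f (mono u v) (mono w z) = 0.
Proof.
move=> hv hz uw; pose la := wt (@sroot n) (u ++ w).
have hla : la \in Gv by apply: wt_in => // i; apply/QGv/root_lattice_sroot.
pose C a b : K^o := theta (Kv la) a * theta (Kv la) b.
have bC : bilin C by apply: bilin_mulr.
have kC i x : theta (Kv la) (Xw i * x) = 0 by rewrite thetaK_mul // thetaKX // mul0r.
have kC1 y : killsX (C^~ y) by move=> i x; rewrite /C kC mul0r.
have kC2 y : killsX (C y) by move=> i x; rewrite /C kC mulr0.
have := dual_character_commutes (mono u v) (mono w z) hla.
rewrite (csum2_monol bC f_bilin kC1 kC2 _ _ hv hz).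
rewrite (csum2_monor bC f_bilin kC1 kC2 _ _ hv hz) /C !thetaKK ?L_in ?R_in //.
rewrite -!qD !wt_lr; set Ra := wt rW u; set Rb := wt rW w.
(* Each left leg exceeds the right leg by a simple root, so the two exponents differ by the pairing
   of [la] with the total weight of the words, which is [la] itself. *)
have -> : - form la (wt (@sroot n) u + Ra + v) + - form la (wt (@sroot n) w + Rb + z)
    = - form la la + (- form la (Ra + v) + - form la (Rb + z)).
  rewrite -!opprD -!root_formDr; congr (- form la _).
  by rewrite /la /wt big_cat /=; apply/rowP => i; rewrite !mxE; ring.
set x := - form la (Ra + v) + _; rewrite [in RHS]qD => /eqP.
rewrite -[X in X == _]mulr1 -subr_eq0.
have -> : q x *: f (mono u v) (mono w z) * 1 - (q (- form la la) * q x) *: f (mono u v) (mono w z)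
   = (1 - q (- form la la)) * q x * f (mono u v) (mono w z).
  by rewrite -[q x *: _]/(q x * _) -[_ *: f _ _]/(_ * _); ring.
rewrite !mulf_eq0 (negbTE (qneq0 _)) orbF => /orP[|/eqP //].
rewrite subr_eq0 => /eqP/esym/q_inj/eqP; rewrite oppr_eq0 => /eqP e.
by have := wt_sroot_pos hA uw; rewrite -/la e ltxx.
Qed.

Lemma dual_f_kills1 y : killsX (f^~ y).
Proof.
move=> i x; apply: (mono_ext2 Gw0 GwN GwD (f := fun x y => f (Xw i * x) y)
  (g := fun _ _ => 0)) => [||u v w z hv hz].
- by apply: bilinP => z c a b /=; rewrite ?mulrDr -?scalerAr ?lf1 ?lf2.
- by apply: bilinP => z c a b /=; rewrite scaler0 addr0.
- exact: (@dual_f_mono (i :: u)).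
Qed.

Lemma dual_f_kills2 x : killsX (f x).
Proof.
move=> i y; apply: (mono_ext2 Gw0 GwN GwD (f := fun x y => f x (Xw i * y))
  (g := fun _ _ => 0)) => [||u v w z hv hz].
- by apply: bilinP => z c a b /=; rewrite ?mulrDr -?scalerAr ?lf1 ?lf2.
- by apply: bilinP => z c a b /=; rewrite scaler0 addr0.
- by apply: (@dual_f_mono u v (i :: w)) => //; case: (u).
Qed.

End Forward.

Let phi v w := f (Kw v) (Kw w).
(** The deviation of the torus values of sigma from the bicharacter q^(-tw). *)
Let t v w := phi v w * q (tw v w).

Lemma gKE v w : v \in Gw -> w \in Gw -> g (Kw v) (Kw w) = (phi v w)^-1.
Proof.
move=> hv hw; have := fgK hv hw => e.
have p0 : phi v w != 0.
  by apply/eqP => p0; move: e; rewrite -/(phi v w) p0 mul0r => /esym/eqP; rewrite oner_eq0.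
by apply: (mulfI p0); rewrite divff.
Qed.

Lemma phi_neq0 v w : v \in Gw -> w \in Gw -> phi v w != 0.
Proof.
move=> hv hw; apply/eqP => p0; have := fgK hv hw.
by rewrite -/(phi v w) p0 mul0r => /esym/eqP; rewrite oner_eq0.
Qed.

Lemma t0l v : v \in Gw -> t 0 v = 1.
Proof. by move=> hv; rewrite /t /phi Kw0 f1l eWK // twist_form0l q0 mulr1. Qed.

Lemma t0r v : v \in Gw -> t v 0 = 1.
Proof. by move=> hv; rewrite /t /phi Kw0 f1r eWK // twist_form0r q0 mulr1. Qed.

Lemma phi_cocycle a b c : a \in Gw -> b \in Gw -> c \in Gw ->
  phi b c * phi a (b + c) = phi a b * phi (a + b) c.
Proof.
move=> ha hb hc; have := f_cocycle (Kw a) (Kw b) (Kw c).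
have ll x : linear (fun y : W => f (Kw a) (x * y)).
  by move=> e y z /=; rewrite mulrDr -scalerAr lf2.
have lr x : linear (fun y : W => f (x * y) (Kw c)).
  by move=> e y z /=; rewrite mulrDr -scalerAr lf1.
have ll' x : linear (fun y : W => f (Kw a) (y * x)).
  by move=> e y z /=; rewrite mulrDl -scalerAl lf2.
have lr' x : linear (fun y : W => f (y * x) (Kw c)).
  by move=> e y z /=; rewrite mulrDl -scalerAl lf1.
under eq_csum => b1 b2 do rewrite (bc_K bW (bilin_mulr (lf2 b1) (ll b2)) hc).
under [RHS]eq_csum => a1 a2 do rewrite (bc_K bW (bilin_mulr (lf2 a1) (lr a2)) hb).
rewrite (bc_K bW (bilin_mulr (lf1 (Kw c)) (ll' (Kw c))) hb).
rewrite (bc_K bW (bilin_mulr (lf1 (Kw b)) (lr' (Kw b))) ha).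
by rewrite !bKD.
Qed.

Lemma t_cocycle a b c : a \in Gw -> b \in Gw -> c \in Gw ->
  t b c * t a (b + c) = t a b * t (a + b) c.
Proof.
move=> ha hb hc; rewrite /t mulrACA phi_cocycle // [RHS]mulrACA; congr (_ * _).
by rewrite -!qD twist_formDl twist_formDr; congr (q _); ring.
Qed.

Local Notation trivial := (cocycle_trivial Gw t).

(** Duality at X_i is evaluated on (X_i, K_z) and on (K_z, X_i). The pairing of X_i with itself is
    nonzero and cancels, which leaves t(lW i, z) = t(rW i, z) and its mirror image. As one leg is
    zero and the legs differ by alpha_i, either alpha_i or -alpha_i is trivial. *)
Lemma dual_trivial (dual : dual_pairing) i : trivial (sroot i).
Proof.
have [k1 k2] := (dual_f_kills1 dual, dual_f_kills2 dual).
have hr : rW i \in Gw by exact/QGw/rW_in.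
have E1 z : z \in Gw -> t (lW i) z = t (rW i) z.
  move=> hz; have := dual (Xv i) (mono [:: i] 0) (mono [::] z).
  rewrite (m_mono k1 k2) // (linear_mapZ (lth2 _)) thetaX_mul.
  rewrite !thetaX_mono // !thetaK_mono ?(bc_l bV) // mul0r addr0 root_form0l oppr0 q0.
  rewrite (bc_X bP (bilin_mul2 _ _ theta_bilin theta_bilin)).
  rewrite !thetaX_mono // !thetaK_mono ?(bc_l bP) ?(bc_r bP) // mul0r addr0.
  rewrite rPE root_form_psi // mulr1 /toral_coef /wt !big_seq1 !big_nil !addr0 !add0r.
  rewrite gKE // => e.
  have {e} e : phi (lW i) z / phi (rW i) z = q (- tw (sroot i) z).
    apply: (mulIf (thetaXX0 i)); apply: etrans (mulrC _ _); exact: e.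
  have e' : phi (lW i) z = q (- tw (sroot i) z) * phi (rW i) z.
    by rewrite -e divfK // phi_neq0.
  rewrite /t e' lrW twist_formDl qD qN mulrA [_ * phi _ _]mulrC -!mulrA.
  by rewrite [X in _ * X]mulrA mulVf // mul1r.
have E2 z : z \in Gw -> t z (lW i) = t z (rW i).
  move=> hz; have := dual (Xv i) (mono [::] z) (mono [:: i] 0).
  rewrite (m_mono k1 k2) // (linear_mapZ (lth2 _)) thetaX_mul.
  rewrite !thetaX_mono // !thetaK_mono ?(bc_l bV) // mul0r add0r.
  rewrite (bc_X bP (bilin_mul2 _ _ theta_bilin theta_bilin)).
  rewrite !thetaX_mono // !thetaK_mono ?(bc_l bP) ?(bc_r bP) // mul0r add0r.
  rewrite /toral_coef /wt !big_seq1 !big_nil !addr0 !add0r lPE.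
  rewrite gKE // root_formDl opprD qD root_form_psi // => e.
  have {e} e : phi z (lW i) / phi z (rW i) = q (tw (sroot i) z).
    apply: (mulIf (thetaXX0 i)); apply: (mulfI (qneq0 (- form (lP i) z))).
    apply: (mulIf (qneq0 (- tw (sroot i) z))).
    have qq : q (tw (sroot i) z) * q (- tw (sroot i) z) = 1 by rewrite -qD subrr q0.
    transitivity (phi z (lW i) / phi z (rW i) * ((q (- form (lP i) z) *
      q (- tw (sroot i) z)) * theta (Xv i) (Xw i))); first by ring.
    rewrite -[_ * (_ * theta _ _)]/(_ *: _) e -[LHS]mulr1 -qq.
    by ring.
  have e' : phi z (lW i) = q (tw (sroot i) z) * phi z (rW i).
    by rewrite -e divfK // phi_neq0.
  (* The quotient just found is q^(tw(alpha_i, z)); antisymmetry of Psi identifies it with q^(-tw(z,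
     alpha_i)), the value of the same bicharacter in the other slot. *)
  rewrite /t e' lrW twist_formDr qD (twist_form_antisym A (sroot i) z hP) qN.
  rewrite [_ * phi _ _]mulrC -!mulrA.
  by rewrite [X in _ * X]mulrA mulfV // mul1r.
have hs : sroot i \in Gw by apply/QGw/root_lattice_sroot.
have tN := cocycle_trivialN GwN GwD t0l t0r t_cocycle.
(* The first case is that of the negative Borel algebra, with legs 0 and -alpha_i; the second that
   of the positive one, with legs alpha_i and 0. *)
have /orP[/eqP l0E|/eqP r0E'] := lrW0 i.
  have rE : rW i = - sroot i by apply/eqP; rewrite -addr_eq0 addrC -lrW l0E.
  rewrite -[sroot i]opprK; apply: tN; rewrite -rE; split=> [|c hc|c hc].
  - exact/QGw/rW_in.
  - by rewrite -E1 // l0E t0l.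
  - by rewrite -E2 // l0E t0r.
have lE : lW i = sroot i by rewrite lrW r0E' addr0.
split=> // c hc; rewrite -lE.
- by rewrite E1 // r0E' t0l.
- by rewrite E2 // r0E' t0r.
Qed.

Lemma trivial_root_lattice : (forall i, trivial (sroot i)) ->
  forall v, v \in @root_lattice n -> trivial v.
Proof.
move=> h; apply: root_lattice_ind => //; [split=> // | |].
- exact: t0l.
- exact: t0r.
- exact: (cocycle_trivialD GwD t_cocycle).
- exact: (cocycle_trivialN GwN GwD t0l t0r t_cocycle).
Qed.

Lemma phiE v w : trivial v \/ trivial w -> v \in Gw -> w \in Gw ->
  phi v w = q (- tw v w).
Proof.
move=> h hv hw; have e : t v w = 1 by case: h => -[_ h1 h2]; [apply: h1 | apply: h2].
by rewrite -[LHS]mulr1 -q0 -(subrr (tw v w)) qD mulrA -/(t v w) e mul1r.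
Qed.

Lemma corresponding_of_dual : dual_pairing -> corresponding_cocycle Psi f.
Proof.
move=> dual; split.
  have [pi hpi] := torus_projection_exists q A d Gw (~~ s).
  exists pi => // x y.
  rewrite (killsX_proj Gw0 GwN GwD hpi (lf1 y) (dual_f_kills1 dual y)).
  by rewrite (killsX_proj Gw0 GwN GwD hpi (lf2 _) (dual_f_kills2 dual _)).
move=> v w hv hw h; apply: phiE => //.
have ht := trivial_root_lattice (dual_trivial dual).
by case: h => h; [left | right]; apply: ht.
Qed.

(** * From a corresponding cocycle to duality *)

Section Backward.
Hypothesis corr : corresponding_cocycle Psi f.

Let trivQ v : v \in @root_lattice n -> trivial v.
Proof.
move=> hv; have hw := QGw hv; split=> // c hc; rewrite /t /phi.
  by rewrite (corr.2 _ _ hw hc) -?qD ?addNr ?q0 //; left.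
by rewrite (corr.2 _ _ hc hw) -?qD ?addNr ?q0 //; right.
Qed.

Lemma corr_kills1 y : killsX (f^~ y).
Proof.
move=> i x; have [[pi hpi ->] _] := corr.
by rewrite (torus_projection_kill hpi) (linear_map0 (lf1 _)).
Qed.

Lemma corr_kills2 x : killsX (f x).
Proof.
move=> i y; have [[pi hpi ->] _] := corr.
by rewrite (torus_projection_kill hpi) (linear_map0 (lf2 _)).
Qed.

(** Values of sigma outside the root lattice are unknown, but a quotient of two of them is
    determined once [t] takes the same value at both pairs; invariance of [t] under Q supplies this
    for [toral_coefl] and [toral_coefr]. *)
Lemma phi_ratio a b c e : a \in Gw -> b \in Gw -> c \in Gw -> e \in Gw ->
  t a b = t c e -> f (Kw a) (Kw b) * g (Kw c) (Kw e) = q (tw c e - tw a b).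
Proof.
move=> ha hb hc he ht; rewrite gKE // -/(phi a b) qD qN.
apply: (mulIf (phi_neq0 hc he)); rewrite divfK ?phi_neq0 //.
apply: (mulIf (qneq0 (tw a b))); rewrite -/(t a b) ht /t.
by rewrite mulrAC divfK ?qneq0 // mulrC.
Qed.

Lemma toral_coefl i v z : v \in Gw -> z \in Gw ->
  toral_coef [:: i] v [::] z = q (- form (ps i) z).
Proof.
move=> hv hz; rewrite /toral_coef /wt !big_seq1 !big_nil !add0r.
rewrite phi_ratio //; try by apply: GwD => //; apply: QGw.
  rewrite root_form_psi // lrW !twist_formDl; congr (q _); ring.
by rewrite !(cocycle_shiftl GwD t_cocycle) //; apply: trivQ.
Qed.

Lemma toral_coefr i v z : v \in Gw -> z \in Gw ->
  toral_coef [::] v [:: i] z = q (form (ps i) v).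
Proof.
move=> hv hz; rewrite /toral_coef /wt !big_seq1 !big_nil !add0r.
rewrite phi_ratio //; try by apply: GwD => //; apply: QGw.
  rewrite root_form_psi // lrW !twist_formDr.
  by rewrite (twist_form_antisym A (sroot i) v hP); congr (q _); ring.
by rewrite !(cocycle_shiftr GwD t_cocycle) //; apply: trivQ.
Qed.

Lemma toral_coef1 v z : v \in Gw -> z \in Gw -> toral_coef [::] v [::] z = 1.
Proof. by move=> hv hz; rewrite /toral_coef /wt !big_nil !add0r fgK. Qed.

Let mmono := m_mono corr_kills1 corr_kills2.

Let bilin_l v : bilin (fun a b => theta v (m a b)).
Proof.
by apply: bilinP => x c y z /=; rewrite ?m_bilin.1 ?m_bilin.2 lth2.
Qed.

Let bilin_r v : bilin (fun a b => csum dP (fun x y => theta x a * theta y b : K^o) v).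
Proof.
apply: bilinP => x; apply: linear_sum_pointwise => p c y z /=; rewrite lth2.
  by rewrite mulrDl scalerAl.
by rewrite mulrDr scalerAr.
Qed.

Lemma dual_of_corresponding : dual_pairing.
Proof.
apply: (borel_ind Gv0).
- move=> c x y hx hy a b; rewrite lth1 hx hy.
  by rewrite (dP_lin (bilin_mul2 a b theta_bilin theta_bilin)).
- move=> x y hx hy a b.
  rewrite theta_mull (m_comul (bilin_mulr (lth2 x) (lth2 y))).
  rewrite (bc_mul bP (bilin_mul2 a b theta_bilin theta_bilin)).
  under eq_csum => a1 a2 do under eq_csum => b1 b2 do rewrite hx hy.
  under [RHS]eq_csum => x1 x2 do under eq_csum => y1 y2 do rewrite !theta_mull.
  rewrite /csum.
  (* Both sides are now the same fourfold sum over the legs of [x], [y], [a] and [b]; only the order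
     of summation differs. *)
  under eq_bigr => p _ do under eq_bigr => r _ do rewrite big_distrlr /=.
  under [RHS]eq_bigr => p _ do under eq_bigr => r _ do rewrite big_distrlr /=.
  under eq_bigr => p _ do rewrite exchange_big /=.
  rewrite exchange_big /=; apply: eq_bigr => x' _.
  under eq_bigr => p _ do rewrite exchange_big /=.
  rewrite exchange_big /=; apply: eq_bigr => y' _.
  by apply: eq_bigr => p _; apply: eq_bigr => r _; rewrite mulrACA.
- move=> v hv; apply: (mono_ext2 Gw0 GwN GwD) => // u a w b ha hb.
  rewrite mmono // (linear_mapZ (lth2 _)) thetaK_mul //.
  rewrite (bc_K bP (bilin_mul2 _ _ theta_bilin theta_bilin)) // !thetaK_mono //.
  case: u w => [|i u] [|j w]; rewrite ?mul0r ?mulr0 ?scaler0 //.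
  by rewrite toral_coef1 // scale1r.
- move=> i; apply: (mono_ext2 Gw0 GwN GwD) => // u a w b ha hb.
  rewrite mmono // (linear_mapZ (lth2 _)) thetaX_mul.
  rewrite (bc_X bP (bilin_mul2 _ _ theta_bilin theta_bilin)) // !thetaX_mono //.
  rewrite !thetaK_mono ?(bc_l bP) ?(bc_r bP) ?(bc_l bV) //.
  have lV := lPE i; have hr := rPE i.
  (* X_i pairs nontrivially only when the two words have exactly one letter in total. *)
  case: u w => [|j [|k u]] [|j' [|k' w]];
    rewrite ?mul0r ?mulr0 ?addr0 ?add0r ?scaler0 ?mul0r ?mulr0 //.
  + rewrite toral_coefr //; have [<-|ij] := eqVneq i j'; last first.
      by rewrite thetaXX // !mulr0 scaler0.
    rewrite lV root_formDl opprD qD.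
    rewrite -[_ *: _]/(_ * _) !mulrA; congr (_ * _).
    by rewrite mulrC mulrA -qD addNr q0 mul1r.
  + rewrite toral_coefl // root_form0l oppr0 q0 mulr1 hr.
    have [<-|ij] := eqVneq i j; first by rewrite -[_ *: _]/(_ * _) mulrC.
    by rewrite thetaXX // mul0r scaler0.
Qed.

Lemma corr_m_mono u v w z : v \in Gw -> z \in Gw ->
  exists2 c, c != 0 & m (mono u v) (mono w z) = c *: (mono u v * mono w z).
Proof.
move=> hv hz; exists (toral_coef u v w z); last exact: mmono.
rewrite mulf_neq0 ?phi_neq0 ?L_in //.
by rewrite gKE ?R_in // invr_neq0 // phi_neq0 ?R_in.
Qed.

End Backward.

End Duality.

(** * Bijectivity of the antipodes *)

Section AntipodeBijective.
Variables (K : fieldType) (q : rat -> K).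
Hypotheses (q0 : q 0 = 1) (qD : forall r s, q (r + s) = q r * q s).
Variables (n : nat) (A : 'M[int]_n) (d : 'I_n -> nat).
Variables (Gam : set 'rV[rat]_n) (s : bool).
Hypotheses (G0 : 0 \in Gam) (GN : forall v, v \in Gam -> - v \in Gam).
Hypothesis GD : forall v w, v \in Gam -> w \in Gam -> v + w \in Gam.

Local Notation U := (borel q A d Gam s).
Local Notation X := (bX q A d Gam s).
Local Notation Kt := (bK q A d Gam s).
Local Notation mono := (@mono K q n A d Gam s).

Variables (H : hopf U) (r l : 'I_n -> 'rV[rat]_n).
Hypotheses (H1 : hone H = 1).
Hypotheses (HK : forall v, v \in Gam -> hcomul H (Kt v) = pure (Kt v) (Kt v)).
Hypotheses (HX : forall i, hcomul H (X i) = pure (X i) (Kt (r i)) + pure (Kt (l i)) (X i)).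
Hypotheses (eK : forall v, v \in Gam -> hcounit H (Kt v) = 1).
Hypotheses (eX : forall i, hcounit H (X i) = 0).
Hypotheses (Gr : forall i, r i \in Gam) (Gl : forall i, l i \in Gam).
Hypothesis mulH_mono : forall u v w z, v \in Gam -> z \in Gam ->
  exists2 c, c != 0 & hmul H (mono u v) (mono w z) = c *: (mono u v * mono w z).

Local Notation S := (hanti H).
Local Notation "x ** y" := (hmul H x y) (at level 40, left associativity).
Let hA := hopf_mulA (hopfP H).
Let Kt0 : Kt 0 = 1 := bK0 q A d s G0.
Let linS : linear S := hopf_anti_lin (hopfP H).
Let linE : linear (hcounit H : U -> K^o) := hopf_counit_lin (hopfP H).
Let mul_l y : linear ((hmul H)^~ y) := bilin_linl y (hopf_mul_bilin (hopfP H)).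
Let mul_r x : linear (hmul H x) := bilin_linr x (hopf_mul_bilin (hopfP H)).

(** The two products agree up to a scalar, and applying the counit forces this scalar to be 1. *)
Lemma mulH_KK v w : v \in Gam -> w \in Gam -> Kt v ** Kt w = Kt (v + w).
Proof.
move=> hv hw; have [c _] := mulH_mono [::] [::] hv hw; rewrite /= bKD // => e.
have := hopf_counitM (hopfP H) (Kt v) (Kt w).
rewrite e (linear_mapZ linE) !eK ?GD // mulr1.
by rewrite -[c *: 1]/(c * 1) !mulr1 => ->; rewrite scale1r.
Qed.

Lemma hanti_K v : v \in Gam -> S (Kt v) = Kt (- v).
Proof.
move=> hv; have := hopf_antil (hopfP H) (Kt v).
have -> : \sum_(p <- sw (hcomul H) (Kt v)) S p.1 ** p.2
   = tlift (fun a b => S a ** b) (hcomul H (Kt v)) by [].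
rewrite HK // (tlift_pure _ _ (anti_mull_bilin H)) eK // scale1r => e.
rewrite -[LHS](hopf_mul1r (hopfP H)) H1 -Kt0 -(subrr v) -mulH_KK ?GN //.
by rewrite hA e (hopf_mul1l (hopfP H)).
Qed.

Lemma hanti_X i : exists2 c, c != 0 & S (X i) = c *: mono [:: i] (- l i - r i).
Proof.
have := hopf_antil (hopfP H) (X i).
have -> : \sum_(p <- sw (hcomul H) (X i)) S p.1 ** p.2
   = tlift (fun a b => S a ** b) (hcomul H (X i)) by [].
rewrite HX (linear_mapD (tlift_linear (anti_mull_bilin H))).
rewrite !(tlift_pure _ _ (anti_mull_bilin H)) eX scale0r hanti_K // => e.
(* The antipode axiom reads S(X_i) K_(r i) + K_(- l i) X_i = 0; multiply by K_(- r i) on the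
   right. *)
have E : S (X i) = - (Kt (- l i) ** X i ** Kt (- r i)).
  rewrite -[LHS](hopf_mul1r (hopfP H)) H1 -Kt0 -(subrr (r i)) -mulH_KK ?GN // hA.
  rewrite (_ : S (X i) ** Kt (r i) = -1 *: (Kt (- l i) ** X i)).
    by rewrite (linear_mapZ (mul_l _)) scaleN1r.
  by apply/eqP; rewrite scaleN1r -addr_eq0 e.
have Xm : X i = mono [:: i] 0 by rewrite /= Kt0 mulr1.
have [c c0] := mulH_mono [::] [:: i] (GN (Gl i)) G0.
rewrite -[mono [::] _]/(Kt (- l i)) => ec.
have hl : - l i \in Gam by apply: GN.
have hr : - r i \in Gam by apply: GN.
have [c' c0'] := mulH_mono [:: i] [::] hl hr.
rewrite -[mono [::] _]/(Kt (- r i)) => ec'.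
exists (- (c * mono_coef q A d s (- l i) [:: i] * c')).
  by rewrite oppr_eq0 !mulf_neq0 // mono_coef_neq0.
rewrite E {1}Xm ec bK_mono // addr0 scalerA (linear_mapZ (mul_l _)) ec'.
by rewrite mono_bK // scalerA scaleNr.
Qed.

Lemma hanti_sqrX i : exists c, c != 0 /\ S (S (X i)) = c *: X i.
Proof.
have [c c0 e] := hanti_X i.
have hm : - l i - r i \in Gam by rewrite GD // GN.
have Xm : X i = mono [:: i] 0 by rewrite /= Kt0 mulr1.
have [c1 c10] := mulH_mono [:: i] [::] G0 hm.
rewrite -[mono [::] _]/(Kt (- l i - r i)) -{1}Xm => e1.
have hmN : - (- l i - r i) \in Gam by apply: GN.
have [c2 c20] := mulH_mono [::] [:: i] hmN hm.
rewrite -[mono [::] _]/(Kt (- (- l i - r i))) => e2.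
exists (c * c1^-1 * c * c2 * mono_coef q A d s (- (- l i - r i)) [:: i]).
split; first by rewrite !mulf_neq0 ?invr_neq0 ?mono_coef_neq0.
(* The antipode reverses the product of H, not that of the presented algebra, so S(X_i) is first
   rewritten as a product in H. *)
have -> : S (X i) = (c * c1^-1) *: (X i ** Kt (- l i - r i)).
  by rewrite e1 mono_bK // add0r scalerA mulfVK.
rewrite (linear_mapZ linS) hantiM hanti_K // e (linear_mapZ (mul_r _)).
by rewrite e2 bK_mono // addNr -Xm !scalerA.
Qed.

(* On generators the squared antipode only rescales the [X i], and it is
   multiplicative, so it is the grading automorphism with these scalars. *)
Lemma hopf_antipode_bijective : exists2 Si, cancel S Si & cancel Si S.
Proof.
have /choice [b hb] : forall i, exists c, c != 0 /\ S (S (X i)) = c *: X i.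
  exact: hanti_sqrX.
have [T [TK TX]] := scaling_exists q A d Gam s b.
have [T' [TK' TX']] := scaling_exists q A d Gam s (fun i => (b i)^-1).
have Tm u v : v \in Gam -> T (mono u v) = (\prod_(i <- u) b i) *: mono u v.
  move=> hv; elim: u => [|i u IH] /=; first by rewrite big_nil scale1r TK.
  rewrite rmorphM /= TX IH big_cons -scalerAl -scalerAr scalerA //.
have Tm' u v : v \in Gam -> T' (mono u v) = (\prod_(i <- u) b i)^-1 *: mono u v.
  move=> hv; elim: u => [|i u IH] /=; first by rewrite big_nil invr1 scale1r TK'.
  by rewrite rmorphM /= TX' IH big_cons invfM -scalerAl -scalerAr scalerA.
have b0 u : \prod_(i <- u) b i != 0.
  by rewrite prodf_seq_neq0; apply/allP => i _; case: (hb i).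
have lT : linear T by move=> c x y /=; rewrite linearP.
have lT' : linear T' by move=> c x y /=; rewrite linearP.
have SS x : S (S x) = T x.
  move: x; apply: (mono_ext G0 GN GD) => //; first exact: (linear_comp linS).
  move=> u v hv; rewrite Tm //; elim: u => [|i u IH].
    by rewrite big_nil scale1r /= !hanti_K ?opprK // GN.
  (* Trade the product of the presented algebra for that of H, for which the squared antipode is
     multiplicative; the scalar [c] cancels afterwards. *)
  have [c c0 e] := mulH_mono [:: i] u G0 hv.
  rewrite /= Kt0 mulr1 in e; rewrite /=.
  have -> : X i * mono u v = c^-1 *: (X i ** mono u v).
    by rewrite e scalerA mulVf // scale1r.
  rewrite !(linear_mapZ linS) !hantiM IH (hb i).2.
  rewrite (linear_mapZ (mul_l _)) (linear_mapZ (mul_r _)) big_cons !scalerA.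
  by congr (_ *: _); ring.
have T'T x : T' (T x) = x.
  move: x; apply: (mono_ext G0 GN GD) => //; first exact: (linear_comp lT').
  by move=> u v hv; rewrite Tm // (linear_mapZ lT') Tm' // scalerA divff // scale1r.
have TT' x : T (T' x) = x.
  move: x; apply: (mono_ext G0 GN GD) => //; first exact: (linear_comp lT).
  by move=> u v hv; rewrite Tm' // (linear_mapZ lT) Tm // scalerA mulVf // scale1r.
have K1 x : T' (S (S x)) = x by rewrite SS T'T.
exists (fun x => T' (S x)) => // x.
by rewrite -[x in LHS]TT' -SS K1 SS TT'.
Qed.

End AntipodeBijective.

(** * Injectivity of the powers of q, and specialisation to the Borel Hopf algebras *)

Section QRoot.
Variables (k K : fieldType) (q : qroot_field k K).

(** Raising to the denominator of [r] reduces to an integer exponent, and a nonzero one would make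
    the transcendental q a root of X^m - 1. *)
Lemma qroot_inj r : q r = 1 -> r = 0.
Proof.
have qX x m : q (x *+ m) = q x ^+ m.
  by elim: m => [|m IH]; rewrite ?mulr0n ?qpow0 // mulrS qpowD IH exprS.
have qnat m : q m%:R = 1 -> m = 0%N.
  case: m => // m e.
  have p0 : 'X^(m.+1) - 1%:P != 0 :> {poly k}.
    by rewrite -size_poly_eq0 size_XnsubC.
  have := q_transcendental q p0.
  by rewrite rmorphB /= map_polyXn map_polyC /= rmorph1 !hornerE -qX e subrr eqxx.
move=> qr; have e : q (numq r)%:~R = 1.
  have -> : (numq r)%:~R = r *+ `|denq r|%N :> rat.
    by rewrite numqE -mulr_natr natr_absz gtr0_norm ?denq_gt0.
  by rewrite qX qr expr1n.
apply/eqP; rewrite -numq_eq0 -absz_eq0; apply/eqP/qnat.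
case: (numq r) e => m //=; rewrite NegzE rmorphN /= -pmulrn => e.
by have := qpowD q (- m.+1%:R) m.+1%:R; rewrite addNr qpow0 e mul1r => <-.
Qed.

End QRoot.

Section Legs.
Variables (n : nat) (A : 'M[int]_n) (d : 'I_n -> nat).

Lemma psi_minus_of0 v : psi_minus A d 0 v = 0.
Proof. by rewrite psi_minusE mulmx0 mul0mx mulmx0. Qed.

Lemma psi_plus_of0 v : psi_plus A d 0 v = 0.
Proof.
rewrite /psi_plus; do 3![apply: big1 => ? _].
by rewrite mxE !mul0r mulr0 scale0r.
Qed.

Lemma right_leg0 s i : right_leg A d s 0 i = if s then 0 else - sroot i.
Proof. by rewrite /right_leg psi_minus_of0 subr0. Qed.

Lemma left_leg0 s i : left_leg A d s 0 i = if s then sroot i else 0.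
Proof. by rewrite /left_leg psi_plus_of0 addr0 oppr0. Qed.

End Legs.

Section CocycleDeformation.
Variables (k K : fieldType) (q : qroot_field k K).
Variables (n : nat) (A : 'M[int]_n) (d : 'I_n -> nat).
Hypothesis hA : finite_cartan_datum A d.
Variable Psi : 'M[rat]_n.
Hypothesis hP : antisym Psi.

Section Antipodes.
Variables (Gam : set 'rV[rat]_n) (s : bool).
Hypothesis GN : forall v, v \in Gam -> - v \in Gam.
Hypothesis GD : forall v w, v \in Gam -> w \in Gam -> v + w \in Gam.
Hypothesis QG : forall v, v \in @root_lattice n -> v \in Gam.
Let G0 : 0 \in Gam := QG (root_lattice0 n).
Local Notation U := (borel q A d Gam s).

(** Normalisation of [eta] is known for the undeformed counit; this transports it to the twisted
    coproduct. *)
Lemma borel_hopf_counit Phi Phi' (H H' : hopf U) :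
  is_borel_hopf Phi H -> is_borel_hopf Phi' H' -> forall x, hcounit H x = hcounit H' x.
Proof.
move=> [hm h1 _ _ eK eX] [hm' h1' _ _ eK' eX'].
have l : linear (hcounit H : U -> K^o) := hopf_counit_lin (hopfP H).
have l' : linear (hcounit H' : U -> K^o) := hopf_counit_lin (hopfP H').
apply: (borel_ind G0).
- by move=> c x y hx hy; rewrite l l' hx hy.
- move=> x y hx hy; rewrite -{1}hm -hm' (hopf_counitM (hopfP H)).
  by rewrite (hopf_counitM (hopfP H')) hx hy.
- by move=> v hv; rewrite eK ?eK'.
- by move=> i; rewrite eX eX'.
Qed.

Lemma borel_hopf_antipode_bijective Phi (H : hopf U) : is_borel_hopf Phi H ->
  (forall i, right_leg A d s Phi i \in Gam) -> (forall i, left_leg A d s Phi i \in Gam) ->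
  exists2 Si, cancel (hanti H) Si & cancel Si (hanti H).
Proof.
case=> hm h1 hK hX eK eX hr hl.
apply: (hopf_antipode_bijective (qpow0 q) (qpowD q) G0 GN GD h1 hK hX eK eX hr hl).
move=> u v w z _ _; exists 1; first exact: oner_neq0.
by rewrite scale1r; apply: hm.
Qed.

Lemma leg0_in i : right_leg A d s 0 i \in Gam /\ left_leg A d s 0 i \in Gam.
Proof.
rewrite right_leg0 left_leg0; have h := QG (root_lattice_sroot i).
by case: s; split=> //; apply: GN.
Qed.

(** If sigma is already toral for some Phi, comparing its values on simple roots and using
    injectivity of r -> q^r gives A^T Phi A = A^T Psi A, which settles the values outside the root
    lattice as well. *)
Lemma toral_of_corresponding (sig : U -> U -> K) :
  (Gam `<=` @root_lattice n \/ (exists2 Phi, antisym Phi & toral_cocycle_of Phi sig)) ->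
  corresponding_cocycle Psi sig -> toral_cocycle_of Psi sig.
Proof.
move=> h [ft corr]; split=> // v w hv hw; case: h => [sub|[Phi _ [_ tor]]].
  by apply: corr => //; left; rewrite in_setE; apply: sub; rewrite -in_setE.
rewrite tor //; congr (q (- _)); rewrite /twist_form.
suff -> : (AQ A)^T *m Phi *m AQ A = (AQ A)^T *m Psi *m AQ A by [].
apply/matrixP => i j; rewrite -!twist_form_sroot.
have [hi hj] := (QG (root_lattice_sroot i), QG (root_lattice_sroot j)).
have := corr _ _ hi hj (or_introl (root_lattice_sroot i)).
rewrite tor // => e; apply/eqP; rewrite -subr_eq0; apply/eqP.
rewrite -[LHS]opprK; apply/eqP; rewrite oppr_eq0; apply/eqP.
apply: (qroot_inj (q := q)); rewrite opprB addrC qpowD e -qpowD.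
by rewrite addNr qpow0.
Qed.

Lemma toral_corresponding (sig : U -> U -> K) :
  toral_cocycle_of Psi sig -> corresponding_cocycle Psi sig.
Proof. by case=> ft h; split=> // v w hv hw _; apply: h. Qed.

End Antipodes.

Variables (Gv Gw : set 'rV[rat]_n) (s : bool).
Hypothesis GvD : forall v w, v \in Gv -> w \in Gv -> v + w \in Gv.
Hypothesis GwN : forall v, v \in Gw -> - v \in Gw.
Hypothesis GwD : forall v w, v \in Gw -> w \in Gw -> v + w \in Gw.
Hypotheses (QGv : forall v, v \in @root_lattice n -> v \in Gv).
Hypotheses (QGw : forall v, v \in @root_lattice n -> v \in Gw).

Local Notation V := (borel q A d Gv s).
Local Notation W := (borel q A d Gw (~~ s)).
Let Gv0 : 0 \in Gv := QGv (root_lattice0 n).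
Let Gw0 : 0 \in Gw := QGw (root_lattice0 n).

Variables (H : hopf W) (sigma : two_cocycle H) (L : hopf W).
Hypotheses (hH : is_borel_hopf 0 H) (hL : is_cocycle_deformation sigma L).
Local Notation dW := (fun x => sw (hcomul H) x).
Local Notation rW := (right_leg A d (~~ s) 0).
Local Notation lW := (left_leg A d (~~ s) 0).

Let cW : coalg dW (hcounit H) := hopf_coalg H.
Let bW : borel_coalg dW rW lW.
Proof. by apply: borel_hopf_coalg => // i; case: (leg0_in (~~ s) GwN QGw i). Qed.

Let eWK := bhopf_counitK hH.
Let eWX : killsX (hcounit H : W -> K^o).
Proof.
move=> i x; rewrite -(bhopf_mul hH) (hopf_counitM (hopfP H)) (bhopf_counitX hH).
by rewrite mul0r.
Qed.

Let lrW i : lW i = sroot i + rW i.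
Proof. by rewrite left_leg0 right_leg0; case: (~~ s); rewrite ?addr0 ?subrr. Qed.
Let lrW0 i : (lW i == 0) || (rW i == 0).
Proof. by rewrite left_leg0 right_leg0; case: (~~ s); rewrite eqxx ?orbT. Qed.

Let fg1 := coc_invr sigma.
Let gf1 := coc_invl sigma.
Let f_cocycle a b c :
  csum dW (fun b1 b2 => csum dW (fun c1 c2 => sigma b1 c1 * sigma a (b2 * c2) : K^o) c) b
  = csum dW (fun a1 a2 => csum dW (fun b1 b2 => sigma a1 b1 * sigma (a2 * b2) c : K^o) b) a.
Proof.
have := coc_eq sigma a b c => e; etransitivity; [etransitivity; [|exact: e]|].
  by apply: eq_bigr => p _; apply: eq_bigr => r _; rewrite (bhopf_mul hH).
by apply: eq_bigr => p _; apply: eq_bigr => r _; rewrite (bhopf_mul hH).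
Qed.
Let f1l a : sigma 1 a = hcounit H a.
Proof. by rewrite -(bhopf_one hH) coc_norml. Qed.
Let f1r a : sigma a 1 = hcounit H a.
Proof. by rewrite -(bhopf_one hH) coc_normr. Qed.
Let mE a b : hmul L a b =
  csum dW (fun a1 a' => csum dW (fun a2 a3 => csum dW (fun b1 b' => csum dW (fun b2 b3 =>
    (sigma a1 b1 * coc_inv sigma a3 b3) *: (a2 * b2)) b') b) a') a.
Proof.
rewrite (cdef_mul hL); do 4![apply: eq_bigr => ? _].
by rewrite (bhopf_mul hH).
Qed.

Lemma deformation_mono : corresponding_cocycle Psi sigma ->
  forall u v w z, v \in Gw -> z \in Gw -> exists2 c, c != 0 &
    hmul L (mono q A d Gw (~~ s) u v) (mono q A d Gw (~~ s) w z)
    = c *: (mono q A d Gw (~~ s) u v * mono q A d Gw (~~ s) w z).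
Proof.
move=> corr u v w z hv hz.
exact: (corr_m_mono Gw0 GwN GwD QGw cW bW eWK eWX lrW lrW0 (coc_bilin sigma)
  (coc_inv_bilin sigma) fg1 mE corr u w hv hz).
Qed.

Lemma deformation_antipode_bijective : corresponding_cocycle Psi sigma ->
  exists2 Si, cancel (hanti L) Si & cancel Si (hanti L).
Proof.
move=> corr; have [hm h1 hK hX eK eX] := hH; have [_ e1 ec eu] := hL.
apply: (hopf_antipode_bijective (qpow0 q) (qpowD q) Gw0 GwN GwD (r := rW) (l := lW)).
- by rewrite e1.
- by move=> v hv; rewrite ec hK.
- by move=> i; rewrite ec hX.
- by move=> v hv; rewrite eu eK.
- by move=> i; rewrite eu eX.
- by move=> i; case: (leg0_in (~~ s) GwN QGw i).
- by move=> i; case: (leg0_in (~~ s) GwN QGw i).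
- exact: deformation_mono.
Qed.

Variables (dV dP : V -> seq (V * V)) (r0 l0 rP lP : 'I_n -> 'rV[rat]_n).
Hypotheses (bV : borel_coalg dV r0 l0) (bP : borel_coalg dP rP lP).
Variables (eP : V -> K) (cP : coalg dP eP).
Hypotheses (r0E : forall i, r0 i = 0) (rPE : forall i, rP i = psi_minus A d Psi (sroot i)).
Hypothesis lPE : forall i, l0 i = lP i + psi_minus A d Psi (sroot i).
Variable dL : W -> seq (W * W).
Hypothesis dL_or : dL = (fun x => sw (hcomul L) x) \/ dL = swapd (fun x => sw (hcomul L) x).
Variable theta : V -> W -> K^o.
Hypothesis theta_bilin : bilin theta.
Hypothesis theta_mulr : forall v w w',
  theta v (w * w') = csum dV (fun a b => theta a w * theta b w' : K^o) v.
Hypothesis theta_mull : forall v v' w,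
  theta (v * v') w = csum dL (fun a b => theta v a * theta v' b : K^o) w.
Hypothesis thetaKK : forall v w, v \in Gv -> w \in Gw ->
  theta (bK q A d Gv s v) (bK q A d Gw (~~ s) w) = q (- root_form A d v w).
Hypothesis thetaXK : forall i w, w \in Gw ->
  theta (bX q A d Gv s i) (bK q A d Gw (~~ s) w) = 0.
Hypothesis thetaKX : forall v i, v \in Gv ->
  theta (bK q A d Gv s v) (bX q A d Gw (~~ s) i) = 0.
Hypothesis thetaXX : forall i j, theta (bX q A d Gv s i) (bX q A d Gw (~~ s) j)
  = (i == j)%:R / ((q (d i)%:R)^-1 - q (d i)%:R).

Let thetaXX_neq i j : i != j -> theta (bX q A d Gv s i) (bX q A d Gw (~~ s) j) = 0.
Proof. by move=> ij; rewrite thetaXX (negbTE ij) mul0r. Qed.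

Let thetaXX_neq0 i : theta (bX q A d Gv s i) (bX q A d Gw (~~ s) i) != 0.
Proof.
have qn0 r : q r != 0 := qpow_neq0 (qpow0 q) (qpowD q) r.
rewrite thetaXX eqxx mul1r invr_eq0 subr_eq0; apply/eqP => e.
have : q ((d i)%:R + (d i)%:R) = 1 by rewrite qpowD -{1}e mulVf.
move/(@qroot_inj _ _ q); rewrite -natrD => /eqP.
by rewrite pnatr_eq0 addnn double_eq0 (gtn_eqF (cartan_d_gt0 hA i)).
Qed.

Let m_comul (F : W -> W -> K^o) : bilin F -> forall a b,
  csum dL F (hmul L a b) = csum dL (fun a1 a2 => csum dL (fun b1 b2 =>
    F (hmul L a1 b1) (hmul L a2 b2)) b) a.
Proof.
case: dL_or => -> bF a b; first exact: csum_comulM.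
rewrite !csum_swapd (csum_comulM _ _ _ (f := fun a b => F b a)).
  by apply: eq_csum => x y; rewrite csum_swapd.
by apply: bilinP => w c z z' /=; rewrite ?bF.1 ?bF.2.
Qed.

Lemma duality_iff : (forall v a b,
    theta v (hmul L a b) = csum dP (fun x y => theta x a * theta y b : K^o) v)
  <-> corresponding_cocycle Psi sigma.
Proof.
split=> [dual|corr].
  exact: (corresponding_of_dual (qpow0 q) (qpowD q) (@qroot_inj _ _ q) hA hP Gv0 GvD Gw0
    GwN GwD QGv QGw bV bP r0E rPE lPE cW bW eWK eWX lrW lrW0 theta_bilin theta_mulr
    thetaKK thetaXK thetaKX thetaXX_neq0 (coc_bilin sigma) (coc_inv_bilin sigma)
    fg1 gf1 f_cocycle f1l f1r mE dual).
exact: (dual_of_corresponding (qpow0 q) (qpowD q) hA hP Gv0 Gw0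
    GwN GwD QGw bV bP (coalg_lin cP) r0E rPE lPE cW bW eWK eWX lrW lrW0 theta_bilin
    theta_mulr theta_mull
    thetaKK thetaXK thetaKX thetaXX_neq (coc_bilin sigma) (coc_inv_bilin sigma)
    fg1 f_cocycle (hopf_mul_bilin (hopfP L)) mE m_comul corr).
Qed.

End CocycleDeformation.

(** * Skew-Hopf pairings for both signs *)

Lemma skew_pairing_of_duals (K : fieldType) (V W : lmodType K) (H : hopf V) (L : hopf W)
    (eta : V -> W -> K) :
  bilin (eta : V -> W -> K^o) ->
  coproduct_dual_to_product H L eta -> product_dual_to_coproduct H L eta ->
  (forall h, eta h (hone L) = hcounit H h) -> (forall w, eta (hone H) w = hcounit L w) ->
  (exists2 Si, cancel (hanti H) Si & cancel Si (hanti H)) ->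
  (exists2 Si, cancel (hanti L) Si & cancel Si (hanti L)) ->
  skew_hopf_pairing H L eta.
Proof.
move=> b er el e1r e1l [Hi SK KS] [Li SK' KS']; split=> //; exists Hi, Li; split=> //.
exact: (@pairing_anti _ _ _ _ _ (eta : V -> W -> K^o) b er el e1r e1l).
Qed.

Lemma legs_in (n : nat) (A : 'M[int]_n) (d : 'I_n -> nat) (Psi : 'M[rat]_n)
    (Gam : set 'rV[rat]_n) s : antisym Psi ->
  (forall v, v \in Gam -> - v \in Gam) ->
  (forall v w, v \in Gam -> w \in Gam -> v + w \in Gam) ->
  (forall v, v \in @root_lattice n -> v \in Gam) ->
  (forall i, psi_minus A d Psi (sroot i) \in Gam) ->
  (forall i, right_leg A d s Psi i \in Gam) /\ (forall i, left_leg A d s Psi i \in Gam).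
Proof.
move=> hP GN GD QG h; have hs i := QG _ (root_lattice_sroot i).
rewrite /right_leg /left_leg; case: s; split=> i //; rewrite ?psi_plus_minus ?opprK //.
- by rewrite GD // GN.
- by rewrite GD // GN.
Qed.

Theorem theorem5p2p1 (k K : fieldType) (char_k : [pchar k] =i pred0)
    (q : qroot_field k K) (n : nat) (A : 'M[int]_n) (d : 'I_n -> nat)
    (hA : finite_cartan_datum A d) (Gp Gm : set 'rV[rat]_n)
    (lattice_Gp : is_lattice Gp) (lattice_Gm : is_lattice Gm)
    (Q_Gp : @root_lattice n `<=` Gp) (Q_Gm : @root_lattice n `<=` Gm)
    (Psi : 'M[rat]_n) (antisym_Psi : antisym Psi) :
  let Gp' := twisted_lattice A d Psi Gp Gm in
  let Gm' := twisted_lattice A d Psi Gm Gp in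
  let Up := borel q A d Gp' true in
  let Um := borel q A d Gm' false in
  forall (Hp : hopf Up) (Hm : hopf Um) (eta : Up -> Um -> K),
    is_borel_hopf 0 Hp -> is_borel_hopf 0 Hm -> is_standard_pairing Hp Hm eta ->
  (forall (HpPsi : hopf Up) (sigma : two_cocycle Hm) (Hmsigma : hopf Um),
     is_borel_hopf Psi HpPsi -> is_cocycle_deformation sigma Hmsigma ->
     [/\ skew_hopf_pairing HpPsi Hmsigma eta
           <-> corresponding_cocycle Psi sigma,
         coproduct_dual_to_product HpPsi Hmsigma eta
           <-> corresponding_cocycle Psi sigma
       & Gm' `<=` @root_lattice n \/
         (exists2 Phi, antisym Phi & toral_cocycle_of Phi sigma) ->
         (skew_hopf_pairing HpPsi Hmsigma eta
            <-> toral_cocycle_of Psi sigma) /\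
         (coproduct_dual_to_product HpPsi Hmsigma eta
            <-> toral_cocycle_of Psi sigma)])
  /\
  (forall (HmPsi : hopf Um) (sigma : two_cocycle Hp) (Hpsigma : hopf Up),
     is_borel_hopf Psi HmPsi -> is_cocycle_deformation sigma Hpsigma ->
     [/\ skew_hopf_pairing Hpsigma HmPsi eta
           <-> corresponding_cocycle Psi sigma,
         product_dual_to_coproduct Hpsigma HmPsi eta
           <-> corresponding_cocycle Psi sigma
       & Gp' `<=` @root_lattice n \/
         (exists2 Phi, antisym Phi & toral_cocycle_of Phi sigma) ->
         (skew_hopf_pairing Hpsigma HmPsi eta
            <-> toral_cocycle_of Psi sigma) /\
         (product_dual_to_coproduct Hpsigma HmPsi eta
            <-> toral_cocycle_of Psi sigma)]).
Proof.
move=> Gp' Gm' Up Um Hp Hm eta hHp hHm [std KK EF EK KF].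
have GpN : forall v, v \in Gp' -> - v \in Gp' by apply: twisted_latticeN.
have GmN : forall v, v \in Gm' -> - v \in Gm' by apply: twisted_latticeN.
have GpD : forall v w, v \in Gp' -> w \in Gp' -> v + w \in Gp' by apply: twisted_latticeD.
have GmD : forall v w, v \in Gm' -> w \in Gm' -> v + w \in Gm' by apply: twisted_latticeD.
have QGp : forall v, v \in @root_lattice n -> v \in Gp' by apply: root_twisted_lattice.
have QGm : forall v, v \in @root_lattice n -> v \in Gm' by apply: root_twisted_lattice.
have psip i : psi_minus A d Psi (sroot i) \in Gp' by apply: psi_twisted_lattice.
have psim i : psi_minus A d Psi (sroot i) \in Gm' by apply: psi_twisted_lattice.
have [rp lp] := legs_in true antisym_Psi GpN GpD QGp psip.
have [rm lm] := legs_in false antisym_Psi GmN GmD QGm psim.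
have r0p i := (leg0_in A d true GpN QGp i).1.
have l0p i := (leg0_in A d true GpN QGp i).2.
have r0m i := (leg0_in A d false GmN QGm i).1.
have l0m i := (leg0_in A d false GmN QGm i).2.
have bp := borel_hopf_coalg hHp r0p l0p.
have bm := borel_hopf_coalg hHm r0m l0m.
have [etab er el e1r e1l _] := std.
split=> [HpPsi sigma Hmsigma hPsi hsig | HmPsi sigma Hpsigma hPsi hsig].
- have bP := borel_hopf_coalg hPsi rp lp.
  have iff1 : coproduct_dual_to_product HpPsi Hmsigma eta <-> corresponding_cocycle Psi sigma.
    (* [eta] is multiplicative in its first argument along the opposite coproduct, hence the
       reversed orientation of the coproduct of the deformation. *)
    apply: (duality_iff hA antisym_Psi (s := true) GpD GmN GmD QGp QGm hHm hsig
      bp bP (hopf_coalg HpPsi) _ _ _ (or_intror erefl) (theta := eta) etab) => //.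
    + by move=> i; rewrite right_leg0.
    + by move=> i; rewrite left_leg0 /left_leg psi_plus_minus // subrK.
    + by move=> h w w'; rewrite -(bhopf_mul hHm) er.
    + move=> h h' w; rewrite -(bhopf_mul hHp) el csum_swapd /csum.
      by rewrite (cdef_comul hsig).
  have skew : corresponding_cocycle Psi sigma -> skew_hopf_pairing HpPsi Hmsigma eta.
    move=> corr; apply: skew_pairing_of_duals => //.
    + exact/iff1.
    + move=> h h' w; rewrite (bhopf_mul hPsi) -(bhopf_mul hHp) el.
      by rewrite (cdef_comul hsig).
    + by move=> h; rewrite (cdef_one hsig) e1r (borel_hopf_counit QGp hHp hPsi).
    + by move=> w; rewrite (cdef_counit hsig) -e1l (bhopf_one hPsi) (bhopf_one hHp).
    + exact: (borel_hopf_antipode_bijective GpN GpD QGp hPsi rp lp).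
    + exact: (deformation_antipode_bijective (s := true) GmN GmD QGm hHm hsig corr).
  have iff2 : skew_hopf_pairing HpPsi Hmsigma eta <-> corresponding_cocycle Psi sigma.
    by split=> // -[_ h _ _ _ _]; apply/iff1.
  split=> // tor; have e : corresponding_cocycle Psi sigma <-> toral_cocycle_of Psi sigma.
    by split; [apply: toral_of_corresponding | apply: toral_corresponding].
  by rewrite iff1 iff2.
- have bP := borel_hopf_coalg hPsi rm lm.
  have iff1 : product_dual_to_coproduct Hpsigma HmPsi eta <-> corresponding_cocycle Psi sigma.
    suff E : (forall w a b, eta (hmul Hpsigma a b) w = csum (swapd (fun x => sw (hcomul HmPsi) x))
        (fun x y => eta a x * eta b y : K^o) w) <-> corresponding_cocycle Psi sigma.
      split=> [h|/E h]; first apply/E; move=> *; rewrite h csum_swapd //.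
    (* After exchanging the arguments and reversing the coproducts, the right legs are the former
       left legs: 0 in the undeformed case, and -psi_+(alpha_i) = psi_-(alpha_i) in the twisted one,
       exactly as for the other sign. *)
    apply: (duality_iff hA antisym_Psi (s := false) GmD GpN GpD QGm QGp hHp hsig
      (borel_coalg_swapd bm) (borel_coalg_swapd bP) (coalg_swapd (hopf_coalg HmPsi)) _ _ _
      (or_introl erefl) (theta := fun w v => eta v w)) => //.
    + by move=> i; rewrite left_leg0.
    + by move=> i; rewrite /left_leg psi_plus_minus // opprK.
    + by move=> i; rewrite right_leg0 /right_leg subrK.
    + by apply: bilinP => x c y z /=; rewrite ?etab.1 ?etab.2.
    + by move=> w h h'; rewrite -(bhopf_mul hHp) el csum_swapd.
    + move=> w w' h; rewrite -(bhopf_mul hHm) er /csum.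
      by rewrite (cdef_comul hsig).
    + by move=> v w hv hw; rewrite KK // root_formC.
    + by move=> i w hw; apply: KF.
    + by move=> v i hv; apply: EK.
    + move=> i j; rewrite EF eq_sym.
      by case: eqVneq => [->|_] //; rewrite !mul0r.
  have skew : corresponding_cocycle Psi sigma -> skew_hopf_pairing Hpsigma HmPsi eta.
    move=> corr; apply: skew_pairing_of_duals => //.
    + move=> h w w'; rewrite (bhopf_mul hPsi) -(bhopf_mul hHm) er.
      by rewrite (cdef_comul hsig).
    + exact/iff1.
    + by move=> h; rewrite (cdef_counit hsig) -e1r (bhopf_one hPsi) (bhopf_one hHm).
    + by move=> w; rewrite (cdef_one hsig) e1l (borel_hopf_counit QGm hHm hPsi).
    + exact: (deformation_antipode_bijective (s := false) GpN GpD QGp hHp hsig corr).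
    + exact: (borel_hopf_antipode_bijective GmN GmD QGm hPsi rm lm).
  have iff2 : skew_hopf_pairing Hpsigma HmPsi eta <-> corresponding_cocycle Psi sigma.
    by split=> // -[_ _ h _ _ _]; apply/iff1.
  split=> // tor; have e : corresponding_cocycle Psi sigma <-> toral_cocycle_of Psi sigma.
    by split; [apply: toral_of_corresponding | apply: toral_corresponding].
  by rewrite iff1 iff2.
Qed.
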